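(* There exists $\delta>0$ such that, whenever $\Delta t=T/N<\delta$, for any $u_h^0\in\mathcal{S}_h^r$ there exist $U^0,U^1,\dots,U^N\in\mathcal{S}_h^r$ with $U^0=u_h^0$ and $$(\partial U^n,\chi)+(U^{n+1/2}U_x^{n+1/2},\chi)+(U_x^{n+1/2},\chi')-(\mathcal{J}[U^{n+1/2}],\chi')=0\qquad\forall\chi\in\mathcal{S}_h^r,\ n=0,\dots,N-1 .$$
   Context: Fix $L>0$, $T>0$. All functions are real-valued. For real $s\ge 0$, $H^s_{per}$ is the Sobolev space of $2L$-periodic functions on $\mathbf{R}$ of order $s$, with norm $\|\cdot\|_s$ over one period; $\|\cdot\|$ and $(\cdot,\cdot)$ are the norm and inner product of $L^2(-L,L)$. Subscript $x$ and prime denote spatial derivatives. Nonlocal operator (with the integral truncated to $(0,L)$): $\mathcal{J}[\varphi](x)=\int_0^{L}|\xi|^{-1/3}\varphi'(x-\xi)\,d\xi$. Finite element spaces: $r\ge 2$ is an integer. For a partition $-L=x_0<x_1<\dots<x_M=L$ with $h=\max_j(x_{j+1}-x_j)$, $\mathcal{S}_h^r$ is a finite-dimensional subspace of $H^1_{per}$ consisting of continuously differentiable $2L$-periodic piecewise polynomial functions of degree $r-1$. The family $(\mathcal{S}_h^r)$ is assumed to satisfy, for small $h$, $\inf_{\chi\in\mathcal{S}_h^r}\{\|v-\chi\|+h\|(v-\chi)'\|\}\le C h^s\|v\|_s$ for all $v\in H^s_{per}$, $1\le s\le r$, with $C$ independent of $h$ and $v$. Time grid: $N\in\mathbf{N}$,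 $\Delta t=T/N$, $\partial U^n=(U^{n+1}-U^n)/\Delta t$, $U^{n+1/2}=(U^n+U^{n+1})/2$. The threshold $\delta$ does not depend on $h$ or $u_h^0$. *)

(* Defs.v *)
From mathcomp Require Import all_boot all_order all_algebra.
From mathcomp Require Import all_classical all_reals all_analysis.

Set Implicit Arguments.
Unset Strict Implicit.
Unset Printing Implicit Defensive.

Import Order.TTheory GRing.Theory Num.Theory.
Import numFieldNormedType.Exports.

Local Open Scope ring_scope.
Local Open Scope classical_set_scope.

Section PeriodicFunctions.
Variables (R : realType) (L : R).
Implicit Types (u v w g phi : R -> R) (s : R).

(* [periodic f T] (from trigo) says that f has period T *)
Definition period : R := 2 * L.

Definition ip u v : R :=
  \int[@lebesgue_measure R]_(x in `[- L, L]) (u x * v x).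

Definition L2norm u : R := Num.sqrt (ip u u).

Definition L2per v : Prop :=
  [/\ periodic v period, measurable_fun setT v &
      (@lebesgue_measure R).-integrable `[- L, L]
        (fun x => (v x ^+ 2)%:E)].

Definition wavenumber (k : int) : R := k%:~R * pi / L.

(* |c_k|^2 where c_k = (2 L)^-1 \int_(-L)^L v(x) e^(- i k pi x / L) dx is the
   k-th complex Fourier coefficient of the real function v *)
Definition fourier_sqr v (k : int) : R :=
  (ip v (fun x => cos (wavenumber k * x)) / period) ^+ 2 +
  (ip v (fun x => sin (wavenumber k * x)) / period) ^+ 2.

(* Normalised so that, by Parseval, the case s = 0 is the squared L^2(-L, L)
   norm and the case s = 1 is |v|^2 + |v'|^2 *)
Definition sobolev_sqr s v : \bar R :=
  \esum_(k in [set: int])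
    (period * ((1 + wavenumber k ^+ 2) `^ s * fourier_sqr v k))%:E.

Definition Hper s v : Prop := L2per v /\ (sobolev_sqr s v < +oo)%E.

Definition sobolev_norm s v : R := Num.sqrt (fine (sobolev_sqr s v)).

Definition smooth_per phi : Prop :=
  periodic phi period /\
  forall (n : nat) (x : R), derivable (derive1n n phi) x 1.

Definition is_weak_derivative v g : Prop :=
  L2per g /\ forall phi, smooth_per phi -> ip v (derive1 phi) = - ip g phi.

(* The weak derivative is unique up to a null set, so that its L^2 norm does
   not depend on the representative that is chosen here; it exists for every
   v in H^s_per with s >= 1. *)
Definition weak_derivative v : R -> R := xget (cst 0) (is_weak_derivative v).

Definition C1per v : Prop :=
  [/\ periodic v period, forall x : R, derivable v x 1 & continuous (derive1 v)].

(* Used for continuously differentiable phi only, hence the classical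
   derivative *)
Definition nonlocal phi (x : R) : R :=
  \int[@lebesgue_measure R]_(xi in `]0, L[)
    (`|xi| `^ (- (1 / 3)) * derive1 phi (x - xi)).

End PeriodicFunctions.

Section FiniteElements.
Variables (R : realType) (L : R) (r : nat).
Implicit Types (p : seq R) (S : set (R -> R)).

(* A partition -L = x_0 < x_1 < ... < x_M = L is given by the sequence
   p = [:: x_1; ...; x_M] with [itv_partition (- L) L p]. *)
Definition node p (j : nat) : R := nth L (- L :: p) j.

Definition meshsize p : R :=
  \big[Num.max/0]_(j < size p) (node p j.+1 - node p j).

Definition piecewise_poly p (v : R -> R) : Prop :=
  forall j, (j < size p)%N -> exists2 q : {poly R}, (size q <= r)%N &
    forall x, node p j <= x <= node p j.+1 -> v x = q.[x].

Definition linear_subspace S : Prop :=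
  S (fun=> 0) /\
  forall (a : R) (u v : R -> R), S u -> S v -> S (fun x => a * u x + v x).

Definition finite_dimensional S : Prop :=
  exists (n : nat) (b : 'I_n -> R -> R),
    (forall k, S (b k)) /\
    forall v, S v -> exists c : 'I_n -> R, v = fun x => \sum_(k < n) c k * b k x.

Record fe_space p S : Prop := FESpace {
  fe_partition : itv_partition (- L) L p ;
  fe_subspace : linear_subspace S ;
  fe_finite_dimensional : finite_dimensional S ;
  fe_H1per : forall v, S v -> Hper L 1 v ;
  fe_C1per : forall v, S v -> C1per L v ;
  fe_piecewise_poly : forall v, S v -> piecewise_poly p v }.

(* A family of spaces S i over partitions p i, the mesh size of p i playing
   the role of the parameter h *)
Definition approximation_property (I : Type) (p : I -> seq R)
    (S : I -> set (R -> R)) : Prop :=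
  exists2 h0 : R, 0 < h0 &
  forall s : R, 1 <= s <= r%:R -> exists C : R,
  forall (i : I) (v : R -> R), meshsize (p i) < h0 -> Hper L s v ->
    inf [set L2norm L (v \- chi) +
             meshsize (p i) * L2norm L (weak_derivative L (v \- chi))
        | chi in S i]
    <= C * meshsize (p i) `^ s * sobolev_norm L s v.

End FiniteElements.

Section TimeStepping.
Variables (R : realType).
Implicit Types (U : nat -> R -> R) (n : nat).

Definition diffquot (dt : R) U n : R -> R := fun x => (U n.+1 x - U n x) / dt.

Definition midpoint U n : R -> R := fun x => (U n x + U n.+1 x) / 2.

End TimeStepping.

(* Main.v *)
Require Import Defs.
From mathcomp Require Import all_boot all_order all_algebra.
From mathcomp Require Import all_classical all_reals all_analysis.
From mathcomp Require Import measurable_realfun ring lra.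

(* For [W := U^(n+1/2)] the scheme reads [F(W) = 0] on the finite-dimensional
   space [S], where [F] is continuous in the coordinates of [W], and
   [U^(n+1) = 2 W - U^n].  The form [(F(W), W)] is positive on a large sphere:
   the convective term contributes [(W W', W) = 0] by periodicity, and
   [(J[W], W') <= |W'|^2 + C |W|^2] with [C] depending on [L] only, so that
   [2 / dt > C] suffices.  A zero of such an [F] exists by the Poincare-Miranda
   theorem, which follows from a cubical form of Sperner's lemma. *)

(** The threshold may depend neither on [S] nor on the starting value, so [C] has to come from the
    kernel alone. Young's inequality applied directly to [(J[W], W')] puts the kernel mass
    [3 / 2 * L^(2/3)] in front of [|W'|^2], which the viscous term cannot absorb for large [L]. The
    kernel is therefore cut at a small [e], and only the piece on []0, e]] is estimated in this way.
    The starting value affects only the radius of the sphere. On the combinatorial side, the sign of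
    each component is a label in ['F_2]. Modulo 2 no orientation signs occur, and a cell on which
    every label changes is found as a nonzero term of a sum that discrete Stokes evaluates to 1. *)

Set Implicit Arguments.
Unset Strict Implicit.
Unset Printing Implicit Defensive.

Import Order.TTheory GRing.Theory Num.Theory.
Import numFieldNormedType.Exports.
Local Open Scope ring_scope.

(** * Kuhn's combinatorial lemma *)

Section Kuhn.
Variables (n m : nat).
Local Notation pt := {ffun 'I_n -> nat}.
Implicit Types (f g : pt -> 'F_2) (J : {set 'I_n}) (x y q : pt).

Lemma addF2 (a : 'F_2) : a + a = 0.
Proof. by rewrite -mulr2n -mulr_natr (_ : 2%:R = 0 :> 'F_2) ?mulr0 //; apply/val_inj. Qed.

Definition upd x j a : pt := [ffun k => if k == j then a else x k].
Definition gshift j x : pt := upd x j (x j).+1.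
Definition gdiff j f x : 'F_2 := f (gshift j x) - f x.

Lemma gshiftC j l x : gshift j (gshift l x) = gshift l (gshift j x).
Proof.
case: (eqVneq j l) => [-> //|jl]; apply/ffunP => k; rewrite !ffunE.
rewrite (negbTE jl) (eq_sym l) (negbTE jl).
by case: (eqVneq k j) => [->|_] //; rewrite (negbTE jl).
Qed.

(* Coefficient along the directions [J] of the cubical cup product of the
   coboundaries of the functions in the list, with coefficients mod 2. *)
Fixpoint cup (s : seq (pt -> 'F_2)) J x : 'F_2 :=
  if s is f :: s' then \sum_(j in J) gdiff j f x * cup s' (J :\ j) (gshift j x)
  else 1.

(** Every unordered pair of distinct directions is counted twice, hence cancels modulo 2. *)
Lemma sum_sym_eq0 J (F : 'I_n -> 'I_n -> 'F_2) : (forall j l, F j l = F l j) ->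
  \sum_(j in J) \sum_(l in J :\ j) F j l = 0.
Proof.
move=> Fsym.
have E : \sum_(j in J) \sum_(l in J :\ j) F j l =
   \sum_(j in J) \sum_(l in J | (j < l)%N) F j l + \sum_(j in J) \sum_(l in J | (l < j)%N) F j l.
  rewrite -big_split; apply: eq_bigr => j _ /=.
  rewrite (bigID (fun l : 'I_n => (j < l)%N)) /=; congr (_ + _); apply: eq_bigl => l;
    rewrite !inE -(inj_eq val_inj) neq_ltn; case: (l \in J); rewrite ?andbF ?andbT //=;
    by case: ltngtP.
rewrite E [X in _ + X](exchange_big_dep (mem J)) /=; last by move=> ? ? _ /andP[].
rewrite [X in _ + X](eq_bigr (fun j : 'I_n => \sum_(l in J | (j < l)%N) F j l)) ?addF2 //.
by move=> j jJ; apply: eq_big => l; [rewrite jJ | rewrite Fsym].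
Qed.

(* The cup product is a cocycle. *)
Lemma cup_closed s J x : (size s < #|J|)%N -> \sum_(j in J) gdiff j (cup s (J :\ j)) x = 0.
Proof.
elim: s J x => [|f s IH] J x /= hs; first by rewrite big1// => j _; rewrite /gdiff subrr.
(* Discrete Leibniz rule: the first double sum holds second differences of [f], symmetric in [j] and
   [l]; the second reduces to the claim for [s]. *)
have -> : \sum_(j in J) gdiff j (cup (f :: s) (J :\ j)) x =
  \sum_(j in J) \sum_(l in J :\ j)
     (gdiff j (gdiff l f) x * cup s (J :\ j :\ l) (gshift l (gshift j x))) +
  \sum_(j in J) \sum_(l in J :\ j)
     (gdiff l f x * gdiff j (cup s (J :\ l :\ j)) (gshift l x)).
  rewrite -big_split; apply: eq_bigr => j _ /=; rewrite -big_split /gdiff /= -sumrB.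
  apply: eq_bigr => l _; rewrite -/(gdiff _ _ _) [gshift j (gshift l x)]gshiftC.
  by rewrite !finset.setDDl [[set j] :|: _]finset.setUC; ring.
rewrite sum_sym_eq0 ?add0r; last first.
  by move=> j l; rewrite gshiftC !finset.setDDl [[set j] :|: _]finset.setUC /gdiff gshiftC; ring.
rewrite (exchange_big_dep (mem J)) /=; last by move=> i j _ /finset.setD1P[].
rewrite big1 // => l lJ; transitivity (gdiff l f x * 0); last by rewrite mulr0.
rewrite -[in RHS](IH (J :\ l) (gshift l x)).
  rewrite mulr_sumr; apply: eq_bigl => j; rewrite !inE lJ andbT eq_sym.
  by rewrite andbC.
by move: hs; rewrite (cardsD1 l J) lJ ltnS.
Qed.

(** The discrete form of [df w = d(f w)] for a closed [w]: the two sides differ by [f x] times the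
    coboundary of [cup s]. *)
Lemma cup_cons f s J x : (size s < #|J|)%N ->
  cup (f :: s) J x = \sum_(j in J) gdiff j (fun y => f y * cup s (J :\ j) y) x.
Proof.
move=> hs; transitivity (cup (f :: s) J x + f x * \sum_(j in J) gdiff j (cup s (J :\ j)) x).
  by rewrite cup_closed // mulr0 addr0.
rewrite mulr_sumr -big_split /=.
apply: eq_bigr => j _; rewrite -/(cup s) /gdiff; ring.
Qed.

(** Coordinates outside the list are read off from [x], so that a face of a box is again a [boxsum],
    with a shorter list and an updated base point. *)
Fixpoint boxsum (s : seq 'I_n) f x : 'F_2 :=
  if s is j :: s' then \sum_(a < m) boxsum s' f (upd x j a) else f x.

Lemma eq_boxsum s f g x : f =1 g -> boxsum s f x = boxsum s g x.
Proof.
by move=> fg; elim: s x => [|j s IH] x /=; [exact: fg | apply: eq_bigr => a _].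
Qed.

Lemma boxsum0 s f x : (forall y, f y = 0) -> boxsum s f x = 0.
Proof.
by move=> f0; elim: s x => [|j s IH] x //=; rewrite big1.
Qed.

Lemma boxsum_sum s (P : pred 'I_n) (F : 'I_n -> pt -> 'F_2) x :
  boxsum s (fun y => \sum_(j | P j) F j y) x = \sum_(j | P j) boxsum s (F j) x.
Proof.
elim: s x => [|j s IH] x //=; rewrite exchange_big /=.
by apply: eq_bigr => a _; rewrite IH.
Qed.

Lemma updC x j l a b : j != l -> upd (upd x j a) l b = upd (upd x l b) j a.
Proof.
move=> jl; apply/ffunP => k; rewrite !ffunE.
by case: (eqVneq k l) => [->|//]; rewrite eq_sym (negbTE jl).
Qed.

Lemma updU x j a b : upd (upd x j a) j b = upd x j b.
Proof. by apply/ffunP => k; rewrite !ffunE; case: eqP. Qed.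

Lemma boxsum_out s f g x j c : j \notin s -> x j = c ->
  (forall y, y j = c -> f y = g y) -> boxsum s f x = boxsum s g x.
Proof.
move=> js xj fg; elim: s x xj js => [|l s IH] x xj /=; first by move=> _; exact: fg.
rewrite inE negb_or => /andP[jl js]; apply: eq_bigr => a _; apply: IH => //.
by rewrite ffunE (negbTE jl).
Qed.

Lemma sumF_telescope (G : nat -> 'F_2) k : \sum_(a < k) (G a.+1 - G a) = G k - G 0%N.
Proof. by rewrite -(big_mkord xpredT (fun a => G a.+1 - G a)) telescope_sumr. Qed.

Lemma boxsum_upd s g x j a : j \notin s ->
  boxsum s (fun y => g (upd y j a)) x = boxsum s g (upd x j a).
Proof.
elim: s x => [|l s IH] x //=; rewrite inE negb_or => /andP[jl js].
by apply: eq_bigr => b _; rewrite IH // updC // eq_sym.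
Qed.

Lemma boxsumB s f g x : boxsum s (fun y => f y - g y) x = boxsum s f x - boxsum s g x.
Proof.
elim: s x => [|l s IH] x //=; rewrite -sumrB.
by apply: eq_bigr => b _; rewrite IH.
Qed.

(** Stokes' theorem in one direction: the sum over coordinate [j] telescopes to the two opposite
    faces. *)
Lemma boxsum_diff s g x j : uniq s -> j \in s ->
  boxsum s (gdiff j g) x =
  boxsum (rem j s) g (upd x j m) - boxsum (rem j s) g (upd x j 0%N).
Proof.
elim: s x => [|l s IH] x //= /andP[ls us]; rewrite inE eq_sym.
case: (eqVneq l j) => [lj _|lj js] /=.
  rewrite -(sumF_telescope (fun a => boxsum s g (upd x j a))) -lj in ls *.
  apply: eq_bigr => a _.
  transitivity (boxsum s (fun y => g (upd y l a.+1) - g (upd y l a)) (upd x l a)); last first.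
    by rewrite boxsumB !boxsum_upd // !updU.
  apply: (boxsum_out (j := l) (c := a)) => //; rewrite ?ffunE ?eqxx // => y yl.
  rewrite /gdiff /gshift yl; congr (g _ - g _).
  by apply/ffunP => k; rewrite ffunE; case: eqP => // ->.
rewrite -sumrB; apply: eq_bigr => a _; rewrite IH // !(updC _ _ _ lj) //.
Qed.

Lemma boxsum_cst_out s f x j c : j \notin s -> x j = c ->
  (forall y, y j = c -> f y = 0) -> boxsum s f x = 0.
Proof.
by move=> js xj f0; rewrite (boxsum_out (g := fun=> 0) js xj) // boxsum0.
Qed.

Variable lab : 'I_n -> pt -> 'F_2.
Hypothesis lab0 : forall i x, x i = 0%N -> lab i x = 0.
Hypothesis labm : forall i x, x i = m -> lab i x = 1.

(** Moves along [J] never change coordinate [j], so [lab j] is constant along them and its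
    difference, a factor of every term, vanishes. *)
Lemma cup_face s J x j : j \in s -> j \notin J -> x j = 0%N \/ x j = m ->
  cup (map lab s) J x = 0.
Proof.
elim: s J x => [|i s IH] J x //=; rewrite inE => js jJ xj.
have shj l : l \in J -> (gshift l x) j = x j.
  by move=> lJ; rewrite ffunE; case: eqP lJ jJ => // -> ->.
rewrite big1 // => l lJ; case: (eqVneq j i) js => [ji _|_ /= js].
  rewrite /gdiff -ji; case: xj => xj.
    by rewrite !lab0 ?shj // subrr mul0r.
  by rewrite !labm ?shj // subrr mul0r.
by rewrite IH ?mulr0 ?shj // !inE (negbTE jJ) andbF.
Qed.

(** Since [cup] is a divergence, only the faces of the box contribute. Those in a direction other
    than [i] vanish by [cup_face], the face [x i = 0] because [lab i] is 0 there; on the face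
    [x i = m] the factor [lab i] is 1, which leaves the sum for the shorter list. *)
Lemma boxsum_cup s x : uniq s -> boxsum s (cup (map lab s) [set i in s]) x = 1.
Proof.
elim: s x => [|i s IH] x // uis; have /andP[si us] : (i \notin s) && uniq s by [].
have hs : (size (map lab s) < #|[set k in i :: s]|)%N.
  by rewrite size_map cardsE (card_uniqP uis).
rewrite [map _ _]/= (eq_boxsum _ _ (fun y => cup_cons (lab i) y hs)).
have Ei : [set k in i :: s] :\ i = [set k in s].
  by apply/finset.setP => k; rewrite !inE; case: eqP => // ->; rewrite (negbTE si).
rewrite boxsum_sum (bigD1 i) ?inE ?eqxx // big1 ?addr0 ?Ei.
  have := boxsum_diff (fun y => lab i y * cup (map lab s) [set k in s] y) x
    (j := i) uis; rewrite /= inE eqxx => -> //.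
  rewrite [X in _ - X](boxsum_cst_out (c := 0%N) si) ?ffunE ?eqxx //; last first.
    by move=> y yi; rewrite lab0 ?mul0r.
  rewrite subr0 addr0 -[RHS](IH (upd x i m) us).
  apply: (boxsum_out (c := m) si); rewrite ?ffunE ?eqxx // => y yi.
  by rewrite labm // mul1r.
move=> j; rewrite inE => /andP[js ji].
have js' : j \in s by move: js; rewrite inE (negbTE ji).
have jr : j \notin rem j (i :: s) by rewrite mem_rem_uniq // !inE eqxx.
have js2 : j \in i :: s by rewrite inE js' orbT.
have out c x' : c = 0%N \/ c = m -> x' j = c -> boxsum (rem j (i :: s))
    (fun y => lab i y * cup [seq lab i | i <- s] ([set k in i :: s] :\ j) y) x' = 0.
  move=> hc xj; apply: (boxsum_cst_out jr xj) => y yj.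
  by rewrite (cup_face (j := j)) ?mulr0 ?finset.setD11 ?yj.
rewrite boxsum_diff // (out 0%N (upd x j 0%N)) ?(out m (upd x j m)) ?subrr //;
by [rewrite ffunE eqxx | left | right].
Qed.

Lemma boxsum_neq0 s f x : boxsum s f x != 0 ->
  exists y, [/\ forall i, i \in s -> (y i < m)%N, forall i, i \notin s -> y i = x i & f y != 0].
Proof.
elim: s x => [|j s IH] x /=; first by exists x.
move=> h; have [a ha] : exists a : 'I_m, boxsum s f (upd x j a) != 0.
  apply/existsP; apply: contraNT h; rewrite negb_exists => /forallP h.
  by rewrite big1 // => a _; move: (h a); rewrite negbK => /eqP.
have [y [y1 y2 y3]] := IH _ ha; exists y; split => // i; rewrite !inE ?negb_or.
  case: (boolP (i \in s)) => [/y1 //|is_]; rewrite orbF => /eqP ij.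
  by rewrite y2 // ffunE ij eqxx.
by move=> /andP[ij /y2 ->]; rewrite ffunE (negbTE ij).
Qed.

(** Choosing a nonzero summand at each level traces a monotone lattice path from [q], and each label
    of the list jumps at one of its steps; the ends of that step are the witnesses. *)
Lemma cup_neq0 s J q : cup (map lab s) J q != 0 -> forall i, i \in s ->
  exists y z : pt, [/\ forall k, (q k <= y k <= (q k).+1)%N,
    forall k, (q k <= z k <= (q k).+1)%N & lab i y != lab i z].
Proof.
(* A coordinate still in [J] has not been moved yet, which keeps the rest of the path inside the
   unit cube at [q]. *)
suff H : forall x, cup (map lab s) J x != 0 -> (forall k, (q k <= x k <= q k + (k \notin J))%N) ->
   forall i, i \in s -> exists y z : pt, [/\ forall k, (q k <= y k <= (q k).+1)%N,
    forall k, (q k <= z k <= (q k).+1)%N & lab i y != lab i z].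
  by move=> h i si; apply: (H q) => // k; rewrite leqnn leq_addr.
elim: s J => [//|i0 s IH] J x /= h qx i.
have [l lJ hl] : exists2 l, l \in J &
    gdiff l (lab i0) x * cup (map lab s) (J :\ l) (gshift l x) != 0.
  apply/exists_inP; apply: contraNT h; rewrite negb_exists => /forallP h.
  by rewrite big1 // => a aJ; move: (h a); rewrite aJ negbK => /eqP.
have qs k : (q k <= gshift l x k <= q k + (k \notin J :\ l))%N.
  rewrite ffunE !inE; case: eqP => [->|_] /=; last by exact: qx.
  by have := qx l; rewrite lJ /= addn0 addn1 => /andP[h1 h2]; rewrite ltnS h2 leqW.
have le1 (b : bool) k a : (q k <= a <= q k + b)%N -> (q k <= a <= (q k).+1)%N.
  move=> /andP[-> /leq_trans] /= -> //; rewrite -addn1 leq_add2l; exact: leq_b1.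
rewrite inE; case: eqP => [-> _|_ /= si]; last first.
  by apply: (IH (J :\ l) (gshift l x)) => //; apply: contraNneq hl => ->; rewrite mulr0.
exists (gshift l x), x; split; [by move=> k; apply: le1 (qs k)|by move=> k; apply: le1 (qx k)|].
by apply: contraNneq hl => e; rewrite /gdiff e subrr mul0r.
Qed.

Lemma kuhn : exists q : pt, (forall i, (q i < m)%N) /\ forall i,
  exists y z : pt, [/\ forall k, (q k <= y k <= (q k).+1)%N,
    forall k, (q k <= z k <= (q k).+1)%N & lab i y != lab i z].
Proof.
have := @boxsum_cup (enum 'I_n) [ffun=> 0%N] (enum_uniq _).
move=> /eqP; rewrite -(addr0 1) => /eqP h.
have : boxsum (enum 'I_n) (cup (map lab (enum 'I_n)) [set i in enum 'I_n]) [ffun=> 0%N] != 0.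
  by rewrite h addr0 oner_neq0.
move=> /boxsum_neq0 [q [q1 _ q3]]; exists q; split=> i; first by rewrite q1 ?mem_enum.
by apply: cup_neq0 q3 _ _; rewrite mem_enum.
Qed.

End Kuhn.

Local Open Scope classical_set_scope.

(** * The Poincare-Miranda theorem and coercive maps *)

Section Miranda.
Variables (R : realType) (n : nat) (M : R).
Hypothesis M_gt0 : 0 < M.
Definition cube : set 'rV[R]_n := [set x | forall k, - M <= x 0 k <= M].
Variable G : 'I_n -> 'rV[R]_n -> R.
Hypothesis Glo : forall i x, cube x -> x 0 i = - M -> G i x <= 0.
Hypothesis Ghi : forall i x, cube x -> x 0 i = M -> 0 <= G i x.

(** On a grid of mesh below [e], a cell from [kuhn] has vertices where [G i] takes both weak signs,
    for every [i] at once. *)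
Lemma miranda_approx (e : R) : 0 < e -> exists2 X, cube X &
  forall i, exists y z : 'rV[R]_n, [/\ forall k, `|X 0 k - y 0 k| < e,
    forall k, `|X 0 k - z 0 k| < e, 0 <= G i y & G i z <= 0].
Proof.
move=> e0; have [m hm] : exists m, 2 * M / m.+1%:R < e.
  have := archi_boundP (ltW (divr_gt0 (mulr_gt0 (ltr0Sn _ 1) M_gt0) e0)).
  set m := Num.bound _ => hm; exists m.
  rewrite ltr_pdivrMr ?ltr0n // (mulrC e) -ltr_pdivrMr // (lt_trans hm) //.
  by rewrite ltr_nat.
pose X (q : {ffun 'I_n -> nat}) : 'rV[R]_n := \row_i (- M + 2 * M / m.+1%:R * (q i)%:R).
have hpos : 0 < 2 * M / m.+1%:R by rewrite divr_gt0 ?ltr0n // mulr_gt0.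
have top : - M + 2 * M / m.+1%:R * m.+1%:R = M.
  by rewrite divfK ?pnatr_eq0 //; ring.
have Xcube (q : {ffun 'I_n -> nat}) : (forall i, q i <= m.+1)%N -> cube (X q).
  move=> hq k; rewrite mxE lerDl mulr_ge0 ?ler0n ?(ltW hpos) //=.
  by rewrite -[leRHS]top lerD2l ler_wpM2l ?(ltW hpos) // ler_nat.
(* The labels on the faces are prescribed rather than read off from [G]: [G i] may vanish on the
   upper face, and [lab0] and [labm] also concern lattice points outside the cube. *)
pose lab i (q : {ffun 'I_n -> nat}) : 'F_2 := if q i == 0%N then 0 else if q i == m.+1 then 1 else
   if 0 < G i (X q) then 1 else 0.
have lab0 i (q : {ffun 'I_n -> nat}) : q i = 0%N -> lab i q = 0 by rewrite /lab => ->.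
have labm i (q : {ffun 'I_n -> nat}) : q i = m.+1 -> lab i q = 1 by rewrite /lab => ->; rewrite eqxx.
have [q [qm hq]] := kuhn lab0 labm.
exists (X q); first by apply: Xcube => i; exact: ltnW.
move=> i; have [y [z [hy hz hyz]]] := hq i.
have sgn (w : {ffun 'I_n -> nat}) : (forall k, q k <= w k <= (q k).+1)%N ->
    (lab i w = 1 -> 0 <= G i (X w)) /\ (lab i w = 0 -> G i (X w) <= 0).
  move=> hw; have Cw : cube (X w).
    by apply: Xcube => k; have /andP[_ /leq_trans] := hw k; apply; exact: qm.
  rewrite /lab; case: eqP => [w0|_].
    by split=> // _; apply: Glo => //; rewrite mxE w0 mulr0 addr0.
  case: eqP => [wm|_]; first by split=> // _; apply: Ghi => //; rewrite mxE wm.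
  by case: ltP => [/ltW|].
have near (w : {ffun 'I_n -> nat}) : (forall k, q k <= w k <= (q k).+1)%N -> forall k, `|X q 0 k - X w 0 k| < e.
  move=> hw k; rewrite !mxE opprD addrACA subrr add0r -mulrBr normrM gtr0_norm //.
  apply: le_lt_trans hm; rewrite -[leRHS]mulr1 ler_pM2l // distrC.
  have /andP[h1 h2] := hw k; rewrite -natrB // normr_nat -[leRHS]/1%:R ler_nat.
  by rewrite leq_subLR addn1.
have F2 (a : 'F_2) : a = 0 \/ a = 1.
  by case: a => [[|[|//]]] p; [left|right]; apply/val_inj.
have [sy1 sy0] := sgn y hy; have [sz1 sz0] := sgn z hz.
case: (F2 (lab i y)) hyz => ly; case: (F2 (lab i z)) => lz; rewrite ly lz ?eqxx // => _.
  by exists (X z), (X y); split; [exact: near|exact: near|exact: sz1|exact: sy0].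
by exists (X y), (X z); split; [exact: near|exact: near|exact: sy1|exact: sz0].
Qed.

Hypothesis Gcont : forall i, continuous (G i).

Lemma miranda : exists x, forall i, G i x = 0.
Proof.
have /choice[X HX] : forall p : nat, exists X, cube X /\
  forall i, exists y z : 'rV[R]_n, [/\ forall k, `|X 0 k - y 0 k| < p.+1%:R^-1,
    forall k, `|X 0 k - z 0 k| < p.+1%:R^-1, 0 <= G i y & G i z <= 0].
  by move=> p; have [|X] := @miranda_approx p.+1%:R^-1; [rewrite invr_gt0 | exists X].
have Ccomp : compact cube.
  have := @rV_compact R n _ (fun=> @segment_compact R (- M) M).
  by congr compact; apply/seteqP; split=> x hx k; have := hx k; rewrite /= in_itv.
have [x [Cx clx]] : cube `&` cluster (X @ \oo) !=set0.
  by apply: Ccomp; exists 0%N => // p _; exact: (HX p).1.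
(* [x] is a cluster point only, so [p] is chosen with both [X p] within [e / 2] of [x] and tolerance
   below [e / 2]. Applied to the open half-lines, this contradicts the weak signs near [X p]. *)
exists x => i; have close (P : set R) : open P -> P (G i x) ->
    exists p, forall y : 'rV_n, (forall k, `|X p 0 k - y 0 k| < p.+1%:R^-1) -> P (G i y).
  move=> oP Px; have /nbhs_ballP[e /= e0 he] : nbhs x (G i @^-1` P).
    by apply: Gcont; rewrite nbhsE /=; exists P.
  have e20 : 0 < e / 2 by rewrite divr_gt0.
  have FA : (X @ \oo) [set y | exists2 p, y = X p & p.+1%:R^-1 < e / 2].
    have [N _ hN] := near_infty_natSinv_lt (PosNum e20).
    by exists N => // p /hN; exists p.
  have [_ [[p -> pe] [_ bp]]] := clx _ _ FA (nbhsx_ballx x _ e20).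
  exists p => y hy; apply: he; split => // a k; rewrite (ord1 a).
  have := bp 0 k; rewrite /ball /= => h; rewrite -(subrKA (X p 0 k)).
  rewrite (le_lt_trans (ler_normD _ _)) // [ltRHS](splitr e) ltrD // ?(lt_trans (hy k)) //.
apply/eqP; case: ltgtP => // h.
  have [p hp] := close [set t | t < 0] (@open_lt R 0) h.
  by have [_ /(_ i)[y [z [/hp + _ + _]]]] := HX p; rewrite /= => h1 /(lt_le_trans h1); rewrite ltxx.
have [p hp] := close [set t | 0 < t] (@open_gt R 0) h.
by have [_ /(_ i)[y [z [_ /hp + _]]]] := HX p; rewrite /= => h1 /(lt_le_trans h1); rewrite ltxx.
Qed.

End Miranda.

Lemma continuous_sum (R : realType) (T : topologicalType) (J : Type) (s : seq J)
    (f : J -> T -> R) :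
  (forall i, continuous (f i)) -> continuous (fun x => \sum_(i <- s) f i x).
Proof.
move=> cf; elim: s => [|i s IH] x.
  by under eq_fun do rewrite big_nil; exact: cst_continuous.
by under eq_fun do rewrite big_cons; apply: continuousD; [exact: cf | exact: IH].
Qed.

(** * Zeros of maps that point outwards on a sphere *)

Section Coercive.
Variables (R : realType) (n : nat).
Implicit Types x c : 'rV[R]_n.

Definition enorm x : R := Num.sqrt (\sum_k x 0 k ^+ 2).

Lemma continuous_enorm : continuous enorm.
Proof.
move=> x; apply: (@continuous_comp _ _ _ (fun x : 'rV[R]_n => \sum_k x 0 k ^+ 2)); last exact: sqrt_continuous.
apply: continuous_sum => k {}x; apply: (@continuous_comp _ _ _ (fun x : 'rV[R]_n => x 0 k) (fun t => t ^+ 2)).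
  exact: coord_continuous.
exact: exprn_continuous.
Qed.

Lemma le_enorm x k : `|x 0 k| <= enorm x.
Proof.
rewrite -sqrtr_sqr ler_sqrt; last by apply: sumr_ge0 => i _; exact: sqr_ge0.
by rewrite (bigD1 k) //= lerDl sumr_ge0 // => i _; exact: sqr_ge0.
Qed.

Lemma sqr_enorm x : enorm x ^+ 2 = \sum_k x 0 k ^+ 2.
Proof. by rewrite sqr_sqrtr // sumr_ge0 // => i _; exact: sqr_ge0. Qed.

Lemma enormZ (a : R) x : 0 <= a -> enorm (a *: x) = a * enorm x.
Proof.
move=> a0; rewrite /enorm (eq_bigr (fun k => a ^+ 2 * x 0 k ^+ 2)).
  by rewrite -mulr_sumr sqrtrM ?sqr_ge0 // sqrtr_sqr ger0_norm.
by move=> k _; rewrite mxE exprMn.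
Qed.

Variables (rho : R) (F : 'I_n -> 'rV[R]_n -> R).
Hypothesis rho_gt0 : 0 < rho.
Hypothesis Fcont : forall i, continuous (F i).
Hypothesis Fpos : forall x, enorm x = rho -> 0 < \sum_k x 0 k * F k x.

Let P x := (rho / Num.max rho (enorm x)) *: x.

Let max_gt0 x : 0 < Num.max rho (enorm x).
Proof. by rewrite lt_max rho_gt0. Qed.

Let enormP x : enorm (P x) <= rho.
Proof.
rewrite enormZ; last by apply: divr_ge0; exact: ltW.
rewrite -mulrA ler_piMr //; first exact: ltW.
by rewrite ler_pdivrMl ?max_gt0 // mulr1 le_max lexx orbT.
Qed.

Let continuousP : continuous P.
Proof.
move=> x; have cs : {for x, continuous (fun y => rho / Num.max rho (enorm y))}.
  apply: (@continuousM _ _ (fun=> rho) (fun y => (Num.max rho (enorm y))^-1)).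
    exact: cst_continuous.
  apply: (@continuousV _ _ (fun y => Num.max rho (enorm y))); first by rewrite gt_eqF.
  by apply: (@continuous_max R _ (fun=> rho) enorm); [exact: cst_continuous|exact: continuous_enorm].
exact: (cvgZ cs cvg_id).
Qed.

(* [P] is the radial projection onto the ball of radius [rho]; a zero of
   [x - P x + F (P x)] lies in the ball, as outside of it [x - P x] and
   [F (P x)] both have a positive product with [P x]. *)
Lemma coercive_zero : exists x, forall i, F i x = 0.
Proof.
have [B hB] : exists B, forall i x, `|F i (P x)| <= B.
  have /choice[B hB] : forall i, exists B, forall x, `|F i (P x)| <= B.
    move=> i; have Ccomp : compact (cube rho : set 'rV[R]_n).
      have := @rV_compact R n _ (fun=> @segment_compact R (- rho) rho).
      by congr compact; apply/seteqP; split=> x hx k; have := hx k; rewrite /= in_itv.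
    have [B [_ hB]] := compact_bounded (continuous_compact (continuous_subspaceT (@Fcont i)) Ccomp).
    exists (B + 1) => x; apply: hB; first by rewrite ltrDl.
    exists (P x) => // k; rewrite -ler_norml.
    exact: le_trans (le_enorm _ _) (enormP x).
  exists (\sum_i B i) => i x; rewrite (bigD1 i) //=.
  rewrite (le_trans (hB i x)) // lerDl sumr_ge0 // => j _.
  exact: le_trans (normr_ge0 _) (hB j x).
have bnd i x : `|- P x 0 i + F i (P x)| <= rho + B.
  rewrite (le_trans (ler_normD _ _)) // normrN lerD // ?(le_trans (le_enorm _ _)) //.
(* On the faces of this cube the term [x 0 i] dominates the rest, bounded by [rho + B]. The summands
   [1] and [|B|] make [M] positive although the sign of [B] is unknown for [n = 0]. *)
pose M := rho + B + 1 + `|B|.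
have hM : rho + B <= M by rewrite /M -addrA lerDl addr_ge0.
have M0 : 0 < M by move: rho_gt0 (ler_norm (- B)); rewrite normrN /M; lra.
have [|||x hx] := @miranda R n M M0 (fun i x => x 0 i + (- P x 0 i + F i (P x))).
- move=> i x _ ->; have := bnd i x; rewrite ler_norml => /andP[_]; lra.
- move=> i x _ ->; have := bnd i x; rewrite ler_norml => /andP[]; lra.
- move=> i x.
  have cP : {for x, continuous (fun x => P x 0 i)}.
    by apply: (@continuous_comp _ _ _ P (fun x => x 0 i)); [exact: continuousP | exact: coord_continuous].
  have cF : {for x, continuous (fun x => F i (P x))}.
    by apply: (@continuous_comp _ _ _ P (F i)); [exact: continuousP | exact: Fcont].
  exact: cvgD (@coord_continuous _ _ _ 0 i x) (cvgD (cvgN cP) cF).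
exists (P x) => i; have /eqP := hx i; rewrite addrCA addr_eq0 eqr_opp => /eqP PxF.
case: (leP (enorm x) rho) => xr.
  suff E : P x = x by move: PxF; rewrite E; lra.
  by rewrite /P max_l // divff ?gt_eqF // scale1r.
have xpos := lt_trans rho_gt0 xr.
have PE : P x = (rho / enorm x) *: x by rewrite /P max_r // ltW.
have nP : enorm (P x) = rho.
  by rewrite PE enormZ ?divfK ?gt_eqF //; apply: divr_ge0; exact: ltW.
have xE k : x 0 k = (enorm x / rho) * P x 0 k.
  by rewrite PE mxE mulrA mulf_div (mulrC rho) divff ?mul1r // mulf_neq0 // gt_eqF.
(* The sum is negative as [enorm x > rho], against [Fpos]. *)
have := Fpos nP; suff -> : \sum_k P x 0 k * F k (P x) = (1 - enorm x / rho) * rho ^+ 2.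
  rewrite pmulr_lgt0 ?exprn_gt0 // subr_gt0 ltr_pdivrMr // mul1r => /(lt_trans xr).
  by rewrite ltxx.
rewrite -{2}nP sqr_enorm mulr_sumr; apply: eq_bigr => k _.
have := hx k; rewrite {1}xE => h.
have -> : F k (P x) = P x 0 k - enorm x / rho * P x 0 k by lra.
by ring.
Qed.

End Coercive.

(** * Orthonormal bases of finite-dimensional function spaces *)

Section GramSchmidt.
Variables (R : realType) (S : set (R -> R)).
Hypothesis linS : linear_subspace S.

Lemma subspace_sum n (c : 'I_n -> R) (e : 'I_n -> R -> R) :
  (forall k, S (e k)) -> S (fun x => \sum_(k < n) c k * e k x).
Proof.
elim: n c e => [|n IH] c e Se.
  by under eq_fun do rewrite big_ord0; exact: linS.1.
under eq_fun do rewrite big_ord_recl.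
by apply: linS.2 => //; exact: IH.
Qed.

Lemma linear_form_sum (l : (R -> R) -> R) n (c : 'I_n -> R) (e : 'I_n -> R -> R) :
  (forall (a : R) u v, S u -> S v -> l (fun x => a * u x + v x) = a * l u + l v) ->
  (forall k, S (e k)) ->
  l (fun x => \sum_(k < n) c k * e k x) = \sum_(k < n) c k * l (e k).
Proof.
move=> ll; elim: n c e => [|n IH] c e Se.
  under eq_fun do rewrite big_ord0.
  (* Linearity is known on [S] only in the form [a * u + v]; taking [a = -1] and both functions zero
     gives [l 0 = 0]. *)
  have := ll (-1) _ _ linS.1 linS.1.
  under eq_fun do rewrite mulr0 addr0.
  by rewrite big_ord0 mulN1r addNr.
under eq_fun do rewrite big_ord_recl.
by rewrite ll ?IH ?big_ord_recl //; exact: subspace_sum.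
Qed.

Variable B : (R -> R) -> (R -> R) -> R.
Hypothesis B_sym : forall u v, B u v = B v u.
Hypothesis B_lin : forall w (a : R) u v, S w -> S u -> S v ->
  B (fun x => a * u x + v x) w = a * B u w + B v w.
Hypothesis B_gt0 : forall u, S u -> u <> (fun=> 0) -> 0 < B u u.

Lemma gram_schmidt n (b : 'I_n -> R -> R) : (forall k, S (b k)) ->
  exists m (e : 'I_m -> R -> R), [/\ forall k, S (e k),
    forall j k, B (e j) (e k) = (j == k)%:R &
    forall k, exists c : 'I_m -> R, b k = fun x => \sum_(j < m) c j * e j x].
Proof.
elim: n b => [|n IH] b Sb.
  by exists 0%N, (fun k x => 0); split; case.
have [m [e [Se ortho bspan]]] := IH (fun k => b (lift ord0 k)) (fun k => Sb _).
pose pr x := \sum_(k < m) B (b ord0) (e k) * e k x.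
have Spr : S pr by exact: subspace_sum.
(* The shape [a * u + v] is the one under which [linear_subspace] is closed; the same holds for [f]
   below. *)
pose w x := -1 * pr x + b ord0 x.
have Sw : S w by exact: linS.2.
have wo k : B w (e k) = 0.
  rewrite B_lin // (linear_form_sum (l := B ^~ (e k))) //; last first.
    by move=> *; exact: B_lin.
  rewrite (bigD1 k) //= ortho eqxx mulr1 big1 ?addr0 ?mulN1r ?addNr // => j jk.
  by rewrite ortho (negbTE jk) mulr0.
have bE x : b ord0 x = pr x + w x by rewrite /w mulN1r addNKr.
(* The family [b] spans but may be dependent: a vector with zero residual is dropped. *)
have [w0|/eqP w0] := pselect (w = fun=> 0).
  exists m, e; split => // k; have [k' ->|->] := unliftP ord0 k; first exact: bspan.
  exists (fun k => B (b ord0) (e k)); apply/funext => x.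
  by rewrite bE w0 addr0.
have Bw : 0 < B w w by apply: B_gt0 => //; exact/eqP.
pose s := Num.sqrt (B w w).
have s0 : 0 < s by rewrite sqrtr_gt0.
pose f x := s^-1 * w x + 0.
have Sf : S f by apply: (linS.2 _ _ (fun=> 0)) => //; exact: linS.1.
have B0 v : S v -> B (fun=> 0) v = 0.
  move=> Sv; have := B_lin (-1) Sv linS.1 linS.1.
  by under eq_fun do rewrite mulr0 addr0; rewrite mulN1r addNr.
have Bf v : S v -> B f v = s^-1 * B w v.
  by move=> Sv; rewrite (@B_lin _ _ _ (fun=> 0)) ?B0 ?addr0 //; exact: linS.1.
pose e' (k : 'I_m.+1) := if unlift ord0 k is Some k' then e k' else f.
have e'0 : e' ord0 = f by rewrite /e' unlift_none.
have e'S k : e' (lift ord0 k) = e k by rewrite /e' liftK.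
exists m.+1, e'; split.
- by move=> k; rewrite /e'; case: unliftP.
- move=> j k; have [j' ->|->] := unliftP ord0 j; have [k' ->|->] := unliftP ord0 k;
    rewrite ?e'0 ?e'S ?ortho ?(inj_eq lift_inj) ?eqxx //.
  + by rewrite B_sym Bf // wo mulr0.
  + by rewrite Bf // wo mulr0.
  + by rewrite Bf // B_sym Bf // mulrA -invfM -expr2 sqr_sqrtr ?ltW // mulVf // gt_eqF.
- move=> k; have [k' ->|->] := unliftP ord0 k.
    have [c ->] := bspan k'.
    exists (fun k => if unlift ord0 k is Some k' then c k' else 0); apply/funext => x.
    rewrite big_ord_recl unlift_none mul0r add0r.
    by apply: eq_bigr => i _; rewrite liftK e'S.
  exists (fun k => if unlift ord0 k is Some k' then B (b ord0) (e k') else s); apply/funext => x.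
  rewrite big_ord_recl unlift_none e'0 bE addrC; congr (_ + _).
    by rewrite /f addr0 mulrA divff ?mul1r // gt_eqF.
  by apply: eq_bigr => i _; rewrite liftK e'S.
Qed.

(** Orthonormality turns the Euclidean norm of the coordinates into the norm given by [B], so that a
    sphere in coordinates is a sphere in [S]. *)
Lemma orthonormal_basis : finite_dimensional S ->
  exists m (e : 'I_m -> R -> R), [/\ forall k, S (e k),
    forall j k, B (e j) (e k) = (j == k)%:R &
    forall v, S v -> exists c : 'I_m -> R, v = fun x => \sum_(j < m) c j * e j x].
Proof.
move=> [n [b [Sb bspan]]]; have [m [e [Se ortho /choice[c cE]]]] := gram_schmidt Sb.
exists m, e; split => // v /bspan[d ->].
exists (fun j => \sum_(k < n) d k * c k j); apply/funext => x.
under [RHS]eq_bigr do rewrite mulr_suml.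
rewrite exchange_big /=; apply: eq_bigr => k _; rewrite cE mulr_sumr.
by apply: eq_bigr => j _; rewrite mulrA.
Qed.

End GramSchmidt.

(** * Integrals of continuous periodic functions *)

Section ContinuousIntegrals.
Variable R : realType.
Local Notation mu := (@lebesgue_measure R).
Implicit Types (f g F : R -> R) (a b x : R).

Lemma continuous_integrable f a b : continuous f -> mu.-integrable `[a, b] (EFin \o f).
Proof.
move=> cf; apply: continuous_compact_integrable; first exact: segment_compact.
exact: continuous_subspaceT.
Qed.

Lemma integrable_scale (D : set (measurableTypeR R)) c f : measurable D ->
  mu.-integrable D (EFin \o f) -> mu.-integrable D (EFin \o (fun x => c * f x)).
Proof.
move=> mD int; have := integrableZl mD c int.
by apply: eq_integrable => // y _ /=; rewrite EFinM.
Qed.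

Lemma is_derive_continuous F (d x : R) : is_derive x 1 F d -> {for x, continuous F}.
Proof. by move=> h; apply: differentiable_continuous; apply/derivable1_diffP; exact: ex_derive. Qed.

Lemma derive1_oo_LRcontinuous F f a b :
  (forall x, a <= x <= b -> is_derive x 1 F (f x)) -> a < b ->
  derivable_oo_LRcontinuous F a b /\ {in `]a, b[%R, derive1 F =1 f}.
Proof.
move=> dF ab; split; last first.
  move=> x; rewrite in_itv /= => /andP[ax xb].
  have dx : is_derive x 1 F (f x) by apply: dF; rewrite !ltW.
  by rewrite derive1E derive_val.
split.
- move=> x; rewrite in_itv /= => /andP[ax xb].
  by have [] : is_derive x 1 F (f x) by apply: dF; rewrite !ltW.
- apply: cvg_at_right_filter; apply: (@is_derive_continuous F (f a)).
  by apply: dF; rewrite lexx ltW.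
- apply: cvg_at_left_filter; apply: (@is_derive_continuous F (f b)).
  by apply: dF; rewrite lexx ltW.
Qed.

Lemma Rintegral_is_derive F f a b : a < b -> continuous f ->
  (forall x, a <= x <= b -> is_derive x 1 F (f x)) ->
  \int[mu]_(x in `[a, b]) f x = F b - F a.
Proof.
move=> ab cf /derive1_oo_LRcontinuous/(_ ab)[dF F'f]; rewrite /Rintegral.
by rewrite (continuous_FTC2 ab _ dF F'f) //; exact: continuous_subspaceT.
Qed.

(** The primitive is an integral from [a], hence is controlled only to the right of [a]; users pick
    [a] far enough to the left. *)
Lemma primitive_exists f a : continuous f ->
  exists F, forall x, a < x -> is_derive x 1 F (f x).
Proof.
move=> cf; exists (fun x => \int[mu]_(t in `[a, x]) f t) => x ax.
have xx : x < x + 1 by rewrite ltrDl.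
have [dF F'] := @continuous_FTC1_closed R f a x (x + 1) xx
  (continuous_integrable a (x + 1) cf) ax (cf x).
by apply: (DeriveDef dF); rewrite -derive1E F'.
Qed.

Lemma is_derive_shift F (d x c : R) : is_derive (x + c) 1 F d ->
  is_derive x 1 (fun y => F (y + c)) d.
Proof.
move=> dF; have dx : is_derive x 1 (fun y => y + c) (1 + 0) by exact: is_deriveD.
rewrite addr0 in dx.
have := @is_derive1_comp R F (fun y => y + c) x d 1 dF dx.
by rewrite mulr1.
Qed.

Lemma continuous_shift f c : continuous f -> continuous (fun x => f (x + c)).
Proof.
move=> cf x; apply: (@continuous_comp _ _ _ (fun y => y + c) f); last exact: cf.
by apply: cvgD; [exact: cvg_id | exact: cvg_cst].
Qed.

Lemma Rintegral_periodic L f c : 0 < L -> continuous f -> periodic f (period L) ->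
  \int[mu]_(x in `[- L, L]) f (x + c) = \int[mu]_(x in `[- L, L]) f x.
Proof.
(* For [c <= 0] a primitive based at [- L + c - 1] covers both intervals; the other sign follows by
   shifting back. *)
move=> L0; wlog c0 : f c / c <= 0.
  move=> H cf pf; case: (leP c 0) => [c0|/ltW c0]; first exact: H.
  have := H (fun x => f (x + c)) (- c); rewrite oppr_le0 => /(_ c0) <-.
  - by apply: eq_Rintegral => x _; rewrite subrK.
  - exact: continuous_shift.
  - by move=> x; rewrite addrAC pf.
move=> cf pf; have [F dF] := primitive_exists (- L + c - 1) cf.
have dFx d x : - L + c <= x + d -> is_derive x 1 (fun y => F (y + d)) (f (x + d)).
  by move=> h; apply: is_derive_shift; apply: dF; lra.
have LL : - L < L by lra.
have mono x d : - L <= x <= L -> c <= d -> - L + c <= x + d by move=> /andP[]; lra.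
have -> : \int[mu]_(x in `[- L, L]) f (x + c) = F (L + c) - F (- L + c).
  apply: (@Rintegral_is_derive (fun y => F (y + c))) => //; first exact: continuous_shift.
  by move=> x /mono xL; apply: dFx; exact: xL.
have -> : \int[mu]_(x in `[- L, L]) f x = F (L + 0) - F (- L + 0).
  apply: (@Rintegral_is_derive (fun y => F (y + 0))) => //.
  by move=> x /mono xL; rewrite -[in f x](addr0 x); apply: dFx; exact: xL.
(* By periodicity [h] has derivative zero, so it agrees at [- L + c] and [- L], which is the claim
   in terms of [F]. *)
pose h y := F (y + period L) - F (y + 0).
have dh y : - L + c <= y -> is_derive y 1 h 0.
  move=> hy; have e : f (y + period L) = f (y + 0) by rewrite addr0 pf.
  rewrite -(subrr (f (y + 0))) -{1}e; apply: is_deriveB.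
    by apply: dFx; rewrite /period; lra.
  by apply: dFx; rewrite addr0.
have Lc : - L + c <= - L by lra.
have [||z _ hz] := @MVT_segment R h (fun=> 0) _ _ Lc.
- by move=> y; rewrite in_itv /= => /andP[/ltW /dh].
- apply: derivable_within_continuous => y; rewrite in_itv /= => /andP[/dh dy _].
  exact: ex_derive.
move: hz; rewrite mul0r /h /period !addr0.
have -> : - L + 2 * L = L by ring.
have -> : - L + c + 2 * L = L + c by ring.
lra.
Qed.

End ContinuousIntegrals.

(** * The inner product of continuous functions over one period *)

Section InnerProduct.
Variables (R : realType) (L : R).
Hypothesis L_gt0 : 0 < L.
Local Notation mu := (@lebesgue_measure R).
Implicit Types (f g u v w : R -> R) (a c x : R).

Lemma continuous_mul u v : continuous u -> continuous v -> continuous (fun x => u x * v x).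
Proof. by move=> cu cv x; exact: cvgM (cu x) (cv x). Qed.

Lemma continuous_lincomb a u v : continuous u -> continuous v ->
  continuous (fun x => a * u x + v x).
Proof.
by move=> cu cv x; apply: cvgD; [exact: cvgM (cvg_cst _) (cu x) | exact: cv].
Qed.

Lemma ip_sym u v : ip L u v = ip L v u.
Proof. by apply: eq_Rintegral => x _; rewrite mulrC. Qed.

Lemma ip_linear w a u v : continuous w -> continuous u -> continuous v ->
  ip L (fun x => a * u x + v x) w = a * ip L u w + ip L v w.
Proof.
move=> cw cu cv; rewrite /ip -RintegralZl //; last first.
  by apply: continuous_integrable; exact: continuous_mul.
rewrite -RintegralD //.
- by apply: eq_Rintegral => x _; rewrite mulrDl mulrA.
- apply: continuous_integrable; apply: (@continuous_mul (fun=> a)); first exact: cst_continuous.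
  exact: continuous_mul.
- by apply: continuous_integrable; exact: continuous_mul.
Qed.

Lemma ipZl w a u : continuous w -> continuous u -> ip L (fun x => a * u x) w = a * ip L u w.
Proof.
move=> cw cu; rewrite /ip -RintegralZl //.
  by apply: eq_Rintegral => x _; rewrite mulrA.
by apply: continuous_integrable; exact: continuous_mul.
Qed.

Lemma ip_ge0 u : 0 <= ip L u u.
Proof. by apply: Rintegral_ge0 => x _; rewrite -expr2 sqr_ge0. Qed.

Lemma ip_shift u c : continuous u -> periodic u (period L) ->
  ip L (fun x => u (x + c)) (fun x => u (x + c)) = ip L u u.
Proof.
move=> cu pu; rewrite /ip (@Rintegral_periodic R L (fun x => u x * u x)) //.
  exact: continuous_mul.
by move=> x; rewrite pu.
Qed.

Lemma ip_gt0 u : continuous u -> periodic u (period L) -> u <> (fun=> 0) -> 0 < ip L u u.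
Proof.
move=> cu pu u0; have [x0 ux0] : exists x0, u x0 != 0.
  apply: contrapT => h; apply: u0; apply/funext => x; apply: contrapT => ux.
  by apply: h; exists x; apply/eqP.
(* A point where [u] is nonzero may lie outside the period or at its end; periodicity moves it to
   the centre 0. *)
rewrite -(ip_shift x0 cu pu); set v := fun x => u (x + x0).
have cv : continuous v by exact: continuous_shift.
have v0 : 0 < v 0 * v 0 by rewrite -expr2 exprn_even_gt0 //= /v add0r.
have /nbhs_ballP[d /= d0 hd] : nbhs (0 : R) [set x | v 0 * v 0 / 2 < v x * v x].
  have /= := continuous_mul cv cv (x := 0).
  move=> /(_ [set y | v 0 * v 0 / 2 < y]); apply; apply: open_nbhs_nbhs.
  by split; [exact: open_gt | rewrite /= gtr_pMr // invf_lt1 // ltr1n].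
pose e := Num.min (d / 2) L.
have e0 : 0 < e by rewrite lt_min divr_gt0.
have ed : e < d by rewrite gt_min ltr_pdivrMr // mulr_natr mulr2n ltrDl d0.
have eL : e <= L by rewrite ge_min lexx orbT.
have int : mu.-integrable `[- L, L] (EFin \o (fun x => v x * v x)).
  by apply: continuous_integrable; exact: continuous_mul.
apply: (@lt_le_trans _ _ (\int[mu]_(x in `[- e, e]) (v 0 * v 0 / 2))).
  rewrite Rintegral_cst //= lebesgue_measure_itv /= lte_fin ifT; last by lra.
  by rewrite -EFinD /= mulr_gt0 ?divr_gt0 //; lra.
have sub : `[- e, e]%classic `<=` `[- L, L]%classic.
  by apply: subset_itv; rewrite bnd_simp; lra.
apply: (@le_trans _ _ (\int[mu]_(x in `[- e, e]) (v x * v x))).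
  apply: le_Rintegral => //.
  - by apply: continuous_integrable; exact: cst_continuous.
  - by apply: continuous_integrable; exact: continuous_mul.
  - move=> x /=; rewrite in_itv /= => /andP[ex xe]; apply/ltW; apply: hd.
    by rewrite /ball /= sub0r normrN ltr_norml; lra.
rewrite /ip /Rintegral fine_le ?integrable_fin_num //.
- by apply: integrableS int.
- apply: ge0_subset_integral => //.
  + by have /integrableP[] := int.
  + by move=> x _; rewrite lee_fin -expr2 sqr_ge0.
Qed.

(** Integrated form of [(a |u| - |v|)^2 >= 0]. *)
Lemma ip_young u v a : 0 < a -> continuous u -> continuous v ->
  `|ip L u v| <= (a * ip L u u + a^-1 * ip L v v) / 2.
Proof.
move=> a0 cu cv.
have int f g : continuous f -> continuous g -> mu.-integrable `[- L, L] (EFin \o (fun x => f x * g x)).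
  by move=> cf cg; apply: continuous_integrable; exact: continuous_mul.
have cw : continuous (fun x => u x * u x * a / 2 + v x * v x * (a^-1 / 2)).
  move=> x; apply: cvgD; last exact: cvgM (continuous_mul cv cv (x := x)) (cvg_cst _).
  by apply: cvgM (cvg_cst _); exact: cvgM (continuous_mul cu cu (x := x)) (cvg_cst _).
apply: le_trans (le_normr_Rintegral _ (int _ _ cu cv)) _ => //.
have -> : (a * ip L u u + a^-1 * ip L v v) / 2 =
   \int[mu]_(x in `[- L, L]) (u x * u x * a / 2 + v x * v x * (a^-1 / 2)).
  rewrite RintegralD //.
  - under eq_Rintegral do rewrite -mulrA.
    rewrite !RintegralZr ?int // /ip; field; lra.
  - by apply: continuous_integrable => x; apply: cvgM (cvg_cst _);
      exact: cvgM (continuous_mul cu cu (x := x)) (cvg_cst _).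
  - by apply: continuous_integrable => x; exact: cvgM (continuous_mul cv cv (x := x)) (cvg_cst _).
apply: le_Rintegral => //.
- apply: continuous_integrable => x; exact: cvg_norm (continuous_mul cu cv (x := x)).
- exact: continuous_integrable.
move=> x _ /=; rewrite -subr_ge0.
have -> : u x * u x * a / 2 + v x * v x * (a^-1 / 2) - `|u x * v x| =
    (a * `|u x| - `|v x|) ^+ 2 / (2 * a).
  have e (t : R) : t * t = `|t| ^+ 2 by rewrite real_normK ?num_real // expr2.
  by rewrite (e (u x)) (e (v x)) normrM; field; rewrite gt_eqF.
by rewrite divr_ge0 ?sqr_ge0 // mulr_ge0 // ltW.
Qed.

End InnerProduct.

(** * Truncated convolutions and the nonlocal operator *)

Section Convolution.
Variable R : realType.
Local Notation mu := (@lebesgue_measure R).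
Variables (L : R) (D : set (measurableTypeR R)) (k : R -> R).
Hypothesis L_gt0 : 0 < L.
Hypothesis mD : measurable D.
Hypothesis subD : forall y : R, D y -> 0 <= y <= L.
Hypothesis ik : mu.-integrable D (EFin \o k).
Implicit Types (f g p : R -> R) (x y : R).

Definition conv f x : R := \int[mu]_(y in D) (k y * f (x - y)).

Lemma continuous_bounded_on f (a b : R) : continuous f ->
  exists2 B, 0 <= B & forall x, a <= x <= b -> `|f x| <= B.
Proof.
move=> cf; have [B [_ hB]] := compact_bounded (continuous_compact
  (continuous_subspaceT cf) (@segment_compact R a b)).
exists (`|B| + 1); first by rewrite addr_ge0.
move=> x xab; apply: hB; first by rewrite (le_lt_trans (ler_norm B)) // ltrDl.
by exists x => //=; rewrite in_itv.
Qed.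

Lemma continuous_subl f x : continuous f -> continuous (fun y => f (x - y)).
Proof.
move=> cf y; apply: (@continuous_comp _ _ _ (fun y => x - y) f); last exact: cf.
by apply: cvgB; [exact: cvg_cst | exact: cvg_id].
Qed.

Lemma measurable_kernel : measurable_fun D k.
Proof. by have /integrableP[/measurable_EFinP] := ik. Qed.

Lemma continuous_measurableR f (A : set R) : measurable A -> continuous f -> measurable_fun A f.
Proof. by move=> mA cf; apply: measurable_funTS; exact: continuous_measurable_fun. Qed.

Lemma integrable_normM (B : R) : mu.-integrable D (EFin \o (fun y => `|k y| * B)).
Proof.
have kn : mu.-integrable D (EFin \o (fun y => `|k y|)) := integrable_norm ik.
have := integrableZr mD B kn.
by apply: eq_integrable => // y _ /=; rewrite EFinM.
Qed.

Lemma conv_integrable f x : continuous f ->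
  mu.-integrable D (EFin \o (fun y => k y * f (x - y))).
Proof.
move=> cf; have [B B0 hB] := continuous_bounded_on (x - L) x cf.
apply: le_integrable (integrable_normM B) => //.
  apply/measurable_EFinP; apply: measurable_funM; first exact: measurable_kernel.
  by apply: continuous_measurableR => //; exact: continuous_subl.
move=> y /subD /andP[y0 yL] /=; rewrite lee_fin !normrM normr_id ler_wpM2l //.
by rewrite (ger0_norm B0); apply: hB; apply/andP; split; lra.
Qed.

Lemma continuous_conv f : continuous f -> continuous (conv f).
Proof.
move=> cf x0; have [B B0 hB] := continuous_bounded_on (x0 - 1 - L) (x0 + 1) cf.
have := @continuity_under_integral R _ _ mu (fun x y => k y * f (x - y)) D mD (x0 - 1) (x0 + 1)
  (fun x _ => conv_integrable x cf) _ _ (integrable_normM B) _ x0.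
apply.
- apply: aeW => y _ x _; apply: cvgM (cvg_cst _) _.
  by have := continuous_shift (c := - y) cf (x := x).
- move=> x; rewrite /= in_itv /= => /andP[x1 x2]; apply: aeW => y /subD /andP[y0 yL].
  by rewrite normrM ler_wpM2l //; apply: hB; apply/andP; split; lra.
- by rewrite inE /= in_itv /=; apply/andP; split; lra.
Qed.

Hypothesis k_ge0 : forall y : R, D y -> 0 <= k y.

(** By Tonelli the integral in [x] may be taken first, and by periodicity it does not depend on the
    shift [y]. *)
Lemma conv_mass p : continuous p -> (forall x, 0 <= p x) -> periodic p (period L) ->
  \int[mu]_(x in `[- L, L]) conv p x =
  (\int[mu]_(y in D) k y) * \int[mu]_(x in `[- L, L]) p x.
Proof.
move=> cp p0 pp; set I : set (measurableTypeR R) := `[- L, L]%classic.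
have mI : measurable I by exact: measurable_itv.
(* Extension by zero off [I * D] lets Tonelli be applied on the whole plane. *)
pose h : measurableTypeR R * measurableTypeR R -> \bar R := EFin \o ((fun z => k z.2 * p (z.1 - z.2)) \_ (I `*` D)).
have h0 z : (0 <= h z)%E.
  rewrite /h /= patchE; case: ifPn => // /set_mem[_ Dz].
  by rewrite lee_fin mulr_ge0 ?k_ge0.
have mh : measurable_fun setT h.
  apply/measurable_EFinP; apply/(measurable_restrictT _ _).1; first exact: measurableX.
  apply: measurable_funM.
    apply: (@measurable_comp _ _ _ _ _ _ D k (I `*` D) snd) => //.
    - by move=> _ [z [_ Dz] <-].
    - exact: measurable_kernel.
    - by apply: measurable_funTS; exact: measurable_snd.
  apply: measurable_funTS; apply: (measurableT_comp (f := p)).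
    exact: continuous_measurable_fun.
  exact: measurable_funB.
have T := @fubini_tonelli _ _ _ _ R mu mu h mh h0.
have hE x y : h (x, y) = if x \in I then (if y \in D then (k y * p (x - y))%:E else 0%E) else 0%E.
  by rewrite /h /= patchE in_setX /=; do 2 case: (_ \in _).
have lhs : (\int[mu]_x \int[mu]_y h (x, y) = \int[mu]_(x in I) (conv p x)%:E)%E.
  rewrite [RHS]integral_mkcond; apply: eq_integral => x _; rewrite patchE.
  under eq_integral do rewrite hE.
  case: ifPn => _; last by rewrite integral0.
  rewrite /conv /Rintegral fineK; last exact: integrable_fin_num (conv_integrable _ cp).
  by rewrite [RHS]integral_mkcond; apply: eq_integral => y _; rewrite patchE.
have rhs : (\int[mu]_y \int[mu]_x h (x, y) =
    \int[mu]_(y in D) ((k y)%:E * (\int[mu]_(x in I) p x)%:E))%E.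
  rewrite [RHS]integral_mkcond; apply: eq_integral => y _; rewrite patchE.
  under eq_integral do rewrite hE.
  case: ifPn => yD; last first.
    by rewrite integral0_eq // => x _; case: ifP.
  have cpy := continuous_shift (c := - y) cp.
  have ip : mu.-integrable I (EFin \o (fun x => p (x - y))).
    by apply: continuous_integrable; exact: cpy.
  have [mp _] := integrableP _ _ _ ip.
  rewrite -(Rintegral_periodic (- y) L_gt0 cp pp) /Rintegral.
  rewrite (fineK (integrable_fin_num mI ip)).
  have p0y x : I x -> (0 <= (p (x - y))%:E)%E by rewrite lee_fin.
  have k0 : (0 <= (k y)%:E)%E by rewrite lee_fin; exact: k_ge0 (set_mem yD).
  rewrite -(ge0_integralZl mu mI mp p0y k0).
  by rewrite [RHS]integral_mkcond; apply: eq_integral => x _; rewrite patchE.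
have iC : mu.-integrable I (EFin \o conv p).
  by apply: continuous_integrable; exact: continuous_conv.
have mk : measurable_fun D (EFin \o k) by apply/measurable_EFinP; exact: measurable_kernel.
have k0 y : D y -> (0 <= (k y)%:E)%E by rewrite lee_fin; exact: k_ge0.
have Ip0 : (0 <= (\int[mu]_(x in I) p x)%:E)%E.
  by rewrite lee_fin; apply: Rintegral_ge0 => x _; exact: p0.
apply: EFin_inj; rewrite {1}/Rintegral (fineK (integrable_fin_num mI iC)).
rewrite -lhs T rhs (ge0_integralZr mu mD mk k0 Ip0) EFinM; congr (_ * _)%E.
by rewrite /Rintegral (fineK (integrable_fin_num mD ik)).
Qed.

Lemma ip_conv_young f g (a : R) : 0 < a -> continuous f -> continuous g ->
  periodic f (period L) ->
  `|ip L (conv f) g| <=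
    (\int[mu]_(y in D) k y) * ((a * ip L f f + a^-1 * ip L g g) / 2).
Proof.
move=> a0 cf cg pf; set m := \int[mu]_(y in D) k y.
have cff : continuous (fun x => f x * f x) by exact: continuous_mul.
have cgg : continuous (fun x => g x * g x) by exact: continuous_mul.
have cC := continuous_conv cff.
(* Young's inequality is used under the integral in [y], on [|f (x - y)| |g x|] with weight [k y];
   [H] is the resulting pointwise bound. *)
pose H x := a / 2 * conv (fun x => f x * f x) x + m * (a^-1 / 2) * (g x * g x).
have c1 (b : R) u : continuous u -> continuous (fun x => b * u x).
  by move=> cu x; exact: cvgM (cvg_cst _) (cu x).
have cH : continuous H by move=> x; exact: cvgD (c1 _ _ cC x) (c1 _ _ cgg x).
have cfg : continuous (fun x => conv f x * g x) by apply: continuous_mul => //; exact: continuous_conv.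
apply: le_trans (le_normr_Rintegral _ (continuous_integrable _ _ cfg)) _ => //.
apply: (@le_trans _ _ (\int[mu]_(x in `[- L, L]) H x)).
  apply: le_Rintegral => //.
  - by apply: continuous_integrable => x; exact: cvg_norm (cfg x).
  - exact: continuous_integrable.
  move=> x _; rewrite normrM.
  have i1 : mu.-integrable D (EFin \o (fun y => k y * (f (x - y) * f (x - y)))).
    exact: (conv_integrable x cff).
  have iR (b : R) u : mu.-integrable D (EFin \o u) -> mu.-integrable D (EFin \o (fun y => b * u y)).
    exact: integrable_scale.
  have E : H x = \int[mu]_(y in D) (a / 2 * (k y * (f (x - y) * f (x - y)))
      + a^-1 / 2 * (g x * g x) * k y).
    rewrite RintegralD ?RintegralZl //; try exact: iR.
    by rewrite /H /conv -/m; ring.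
  have i2 : mu.-integrable D (EFin \o (fun y => `|g x| * (`|k y * f (x - y)|))).
    apply: (iR `|g x| (fun y => `|k y * f (x - y)|)).
    exact: (integrable_norm (conv_integrable x cf)).
  rewrite E mulrC; apply: (@le_trans _ _ (\int[mu]_(y in D) (`|g x| * `|k y * f (x - y)|))).
    rewrite RintegralZl //; last exact: (integrable_norm (conv_integrable x cf)).
    by rewrite ler_wpM2l // le_normr_Rintegral //; exact: conv_integrable.
  apply: le_Rintegral => //.
    have := integrableD mD (iR (a / 2) _ i1) (iR (a^-1 / 2 * (g x * g x)) _ ik).
    by apply: eq_integrable => // y _ /=; rewrite EFinD.
  move=> y Dy; rewrite normrM (ger0_norm (k_ge0 Dy)) -subr_ge0.
  have e (t : R) : t * t = `|t| ^+ 2 by rewrite real_normK ?num_real // expr2.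
  rewrite (e (f _)) (e (g _)).
  have -> : a / 2 * (k y * `|f (x - y)| ^+ 2) + a^-1 / 2 * `|g x| ^+ 2 * k y
      - `|g x| * (k y * `|f (x - y)|) = k y * ((a * `|f (x - y)| - `|g x|) ^+ 2 / (2 * a)).
    by field; rewrite gt_eqF.
  by rewrite mulr_ge0 ?k_ge0 // divr_ge0 ?sqr_ge0 // mulr_ge0 // ltW.
have iI u : continuous u -> mu.-integrable `[- L, L] (EFin \o u) by exact: continuous_integrable.
rewrite /H RintegralD //; [|exact: iI (c1 _ _ cC)|exact: iI (c1 _ _ cgg)].
rewrite !RintegralZl //; [|exact: iI|exact: iI].
rewrite conv_mass //.
- by rewrite -/m /ip; lra.
- by move=> x; rewrite -expr2 sqr_ge0.
- by move=> x; rewrite pf.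
Qed.

End Convolution.

(** * The singular kernel and its mass near the origin *)

Section Kernel.
Variable R : realType.
Local Notation mu := (@lebesgue_measure R).
Implicit Types (a b x y : R).

Definition kern y : R := y `^ (- (1 / 3)).
(** Minus the derivative of [kern], so that it is again a nonnegative kernel to which the
    convolution estimates apply. *)
Definition dkern y : R := 1 / 3 * y `^ (- (1 / 3) - 1).

Lemma kern_ge0 y : 0 <= kern y. Proof. exact: powR_ge0. Qed.

Lemma dkern_ge0 y : 0 <= dkern y.
Proof. by rewrite mulr_ge0 ?powR_ge0 // divr_ge0. Qed.

Lemma is_derive_kern y : 0 < y -> is_derive y 1 kern (- dkern y).
Proof. by move=> y0; rewrite /dkern -mulNr; exact: is_derive1_powR. Qed.

Lemma derivable_dkern y : 0 < y -> derivable dkern y 1.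
Proof.
move=> y0; apply: derivableM; first exact: derivable_cst.
exact: (@ex_derive _ _ _ _ _ _ _ (is_derive1_powR _ y0)).
Qed.

Lemma continuous_within_pos (f : R -> R) a b : 0 < a ->
  (forall y, 0 < y -> derivable f y 1) -> {within `[a, b], continuous f}.
Proof.
move=> a0 df; apply: derivable_within_continuous => y; rewrite in_itv /= => /andP[ay _].
by apply: df; exact: lt_le_trans ay.
Qed.

Lemma derivable_kern y : 0 < y -> derivable kern y 1.
Proof. by move=> y0; exact: (@ex_derive _ _ _ _ _ _ _ (is_derive_kern y0)). Qed.

(** The bound is free of [a], so it survives the limit [a -> 0]. *)
Lemma integral_kern_itv a b : 0 < a -> a < b ->
  (\int[mu]_(y in `[a, b]) (kern y)%:E <= (3 / 2 * b `^ (2 / 3))%:E)%E.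
Proof.
move=> a0 ab; pose F y : R := 3 / 2 * y `^ (2 / 3).
have dF y : a <= y <= b -> is_derive y 1 F (kern y).
  move=> /andP[ay _]; have y0 : 0 < y by exact: lt_le_trans ay.
  have -> : kern y = 3 / 2 *: (2 / 3 * y `^ (2 / 3 - 1)).
    rewrite /kern /GRing.scale /= mulrA (_ : 2 / 3 - 1 = - (1 / 3) :> R); last by field.
    by rewrite (_ : 3 / 2 * (2 / 3) = 1 :> R) ?mul1r //; field.
  by apply: is_deriveZ; exact: is_derive1_powR.
have [LR F'] := derive1_oo_LRcontinuous dF ab.
rewrite (continuous_FTC2 ab _ LR F') //; last first.
  by apply: continuous_within_pos => //; exact: derivable_kern.
by rewrite -EFinB lee_fin lerBlDr lerDl mulr_ge0 ?powR_ge0.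
Qed.

Lemma measurable_kern (D : set (measurableTypeR R)) : measurable_fun D (EFin \o kern).
Proof. by apply/measurable_EFinP; apply: measurable_funTS; exact: measurable_powR. Qed.

Lemma integral_kern_le b : 0 < b ->
  (\int[mu]_(y in `]0%R, b]) (kern y)%:E <= (3 / 2 * b `^ (2 / 3))%:E)%E.
Proof.
(* Exhaustion of []0, b]] for monotone convergence; [n.+2] keeps the left end strictly below [b]. *)
move=> b0; pose F n : set (measurableTypeR R) := `[b / n.+2%:R, b]%classic.
have lb n : 0 < b / n.+2%:R :> R by rewrite divr_gt0.
have FE : \bigcup_n F n = `]0, b]%classic.
  apply/seteqP; split=> [y [n _]|y] /=; rewrite /F /= !in_itv /=.
    by move=> /andP[/(lt_le_trans (lb n)) -> ->].
  move=> /andP[y0 yb]; have := archi_boundP (ltW (divr_gt0 b0 y0)).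
  set n := Num.bound _ => hn; exists n => //=; rewrite in_itv /= yb andbT.
  rewrite ler_pdivrMr // mulrC -ler_pdivrMr // (le_trans (ltW hn)) // ler_nat.
  by rewrite (leq_trans (leqnSn _)).
have := @ge0_nondecreasing_set_cvg_integral _ _ R F (EFin \o kern) mu.
rewrite FE => cv; apply: (cvge_le _ (cv _ _ _ _)).
- by apply: nearW => n; apply: integral_kern_itv; rewrite // ltr_pdivrMr // ltr_pMr // ltr1n.
- apply/nondecreasing_seqP => n; rewrite subsetEset /F; apply: subset_itvr.
  by rewrite bnd_simp ler_pM2l // lef_pV2 ?posrE // ler_nat.
- by move=> n; exact: measurable_itv.
- by move=> n; exact: measurable_kern.
- by move=> n y _; rewrite lee_fin kern_ge0.
Qed.

Lemma kern_integrable b : 0 < b -> mu.-integrable `]0, b] (EFin \o kern).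
Proof.
move=> b0; apply/integrableP; split; first exact: measurable_kern.
under eq_integral do rewrite /= ger0_norm ?kern_ge0 //.
exact: le_lt_trans (integral_kern_le b0) (ltry _).
Qed.

Lemma Rintegral_kern_le b : 0 < b ->
  \int[mu]_(y in `]0, b]) kern y <= 3 / 2 * b `^ (2 / 3).
Proof.
move=> b0; rewrite -lee_fin /Rintegral fineK; first exact: integral_kern_le.
exact: integrable_fin_num (kern_integrable b0).
Qed.

Lemma kern_small L : 0 < L ->
  exists2 e, 0 < e < L & \int[mu]_(y in `]0, e]) kern y <= 1 / 2.
Proof.
(* With [e <= 1 / 8] the mass is at most [3 / 2 * (1 / 8)^(2/3) = 3 / 8]; the bound [L / 2] ensures
   [e < L]. *)
move=> L0; pose e : R := Num.min (L / 2) (1 / 8).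
have e0 : 0 < e by rewrite lt_min !divr_gt0.
exists e.
  by rewrite e0 gt_min ltr_pdivrMr // ltr_pMr // ltr1n.
apply: le_trans (Rintegral_kern_le e0) _.
have e8 : e <= 1 / 8 by rewrite ge_min lexx orbT.
have h : e `^ (2 / 3) <= (1 / 8) `^ (2 / 3).
  apply: ge0_ler_powR => //; rewrite ?nnegrE ?divr_ge0 //; exact: ltW.
have E : (1 / 8) `^ (2 / 3) = 1 / 4 :> R.
  have -> : 1 / 8 = (1 / 2) `^ 3 :> R by rewrite powR_mulrn ?divr_ge0 //; field.
  rewrite -powRrM (_ : 3 * (2 / 3) = 2%:R); last by field.
  by rewrite powR_mulrn ?divr_ge0 //; field.
by move: h; rewrite E; lra.
Qed.

End Kernel.

(** * Continuity, linearity and coercivity estimate of the nonlocal operator *)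

Section Nonlocal.
Variables (R : realType) (L : R).
Hypothesis L_gt0 : 0 < L.
Local Notation mu := (@lebesgue_measure R).
Implicit Types (V : R -> R) (a b x y e : R).

Lemma itv_in_0L (a b : itv_bound R) : (BLeft 0 <= a)%O -> (b <= BRight L)%O ->
  forall y, [set` Interval a b] y -> 0 <= y <= L.
Proof.
move=> a0 bL y /=; rewrite itv_boundlr => /andP[ay yb].
by have := le_trans a0 ay; have := le_trans yb bL; rewrite !bnd_simp => -> ->.
Qed.

Lemma C1per_is_derive V x : C1per L V -> is_derive x 1 V (derive1 V x).
Proof. by move=> [_ dV _]; apply: (DeriveDef (dV x)); rewrite derive1E. Qed.

Lemma C1per_continuous V : C1per L V -> continuous V.
Proof. by move=> hV x; exact: is_derive_continuous (C1per_is_derive x hV). Qed.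

Lemma C1per_derive1_periodic V : C1per L V -> periodic (derive1 V) (period L).
Proof.
move=> hV x; have [pV _ _] := hV.
have h := is_derive_shift (C1per_is_derive (x + period L) hV).
rewrite (_ : (fun y => _) = V) in h; last by apply/funext => y; rewrite pV.
by rewrite [RHS]derive1E (@derive_val _ _ _ _ _ _ _ h).
Qed.

Lemma kern_integrable_itv (a b : itv_bound R) : (BRight 0 <= a)%O -> (b <= BRight L)%O ->
  mu.-integrable [set` Interval a b] (EFin \o (@kern R)).
Proof.
move=> a0 bL; apply: integrableS (kern_integrable L_gt0) => //.
exact: subset_itv.
Qed.

Lemma nonlocal_conv V : C1per L V -> nonlocal L V = conv `]0, L] (@kern R) (derive1 V).
Proof.
move=> [_ _ cV]; apply/funext => x; rewrite /conv -Rintegral_itv_bndo_bndc; last first.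
  apply: (conv_integrable (L := L)) => //; last by apply: kern_integrable_itv; rewrite bnd_simp.
  by apply: itv_in_0L; rewrite bnd_simp.
apply: eq_Rintegral => y; rewrite inE /= in_itv /= => /andP[y0 _].
by rewrite /kern ger0_norm // ltW.
Qed.

Lemma dkern_integrable a : 0 < a -> mu.-integrable `[a, L] (EFin \o (@dkern R)).
Proof.
move=> a0; apply: continuous_compact_integrable; first exact: segment_compact.
exact: continuous_within_pos (@derivable_dkern R).
Qed.

(** On [[e, L]] the kernel is smooth, and integration by parts with the primitive [- V (x - y)] of
    [V' (x - y)] in [y] leaves only values of [V]. *)
Lemma conv_kern_split V x e : 0 < e < L -> C1per L V ->
  nonlocal L V x = conv `]0, e] (@kern R) (derive1 V) x +
    kern e * V (x - e) - kern L * V (x - L) - conv `[e, L] (@dkern R) V x.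
Proof.
move=> /andP[e0 eL] hV; have [_ _ cV'] := hV.
have cV := C1per_continuous hV.
have i0 : mu.-integrable `]0, L] (EFin \o (fun y => kern y * derive1 V (x - y))).
  apply: (conv_integrable (L := L)) => //; last by apply: kern_integrable_itv; rewrite bnd_simp.
  by apply: itv_in_0L; rewrite bnd_simp.
rewrite nonlocal_conv // /conv.
rewrite -[LHS](subrK (\int[mu]_(y in `]0, e]) (kern y * derive1 V (x - y)))).
rewrite Rintegral_itvB // ?bnd_simp ?ltW // addrC -!addrA; congr (_ + _).
rewrite Rintegral_itv_obnd_cbnd; last first.
  by apply: integrableS i0 => //; apply: subset_itv; rewrite bnd_simp // ltW.
have ct (h : R -> R) : continuous h -> {within `[e, L], continuous (fun y => h (x - y))}.
  by move=> ch; apply: continuous_subspaceT; exact: continuous_subl.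
have dG y : e <= y <= L -> is_derive y 1 (fun y => - V (x - y)) (derive1 V (x - y)).
  move=> _; have d1 : is_derive y 1 (fun y => x - y) (0 - 1) by exact: is_deriveB.
  have := is_deriveN (@is_derive1_comp R V _ y _ _ (C1per_is_derive (x - y) hV) d1).
  by rewrite sub0r mulrN1 opprK.
have dF y : e <= y <= L -> is_derive y 1 (@kern R) (- dkern y).
  by move=> /andP[ey _]; apply: is_derive_kern; exact: lt_le_trans ey.
have [LG G'] := derive1_oo_LRcontinuous dG eL.
have [LF F'] := derive1_oo_LRcontinuous dF eL.
rewrite (Rintegration_by_parts eL _ LF F' _ LG G') //; last 2 first.
- apply: continuous_within_pos e0 _ => y y0.
  by apply: derivableN; exact: derivable_dkern.
- exact: ct.
rewrite (_ : \int[mu]_(y in `[e, L]) (- dkern y * - V (x - y)) =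
             \int[mu]_(y in `[e, L]) (dkern y * V (x - y))).
  by ring.
by apply: eq_Rintegral => y _; rewrite mulrNN.
Qed.

Lemma continuous_nonlocal V : C1per L V -> continuous (nonlocal L V).
Proof.
move=> hV; rewrite nonlocal_conv //; apply: (continuous_conv (L := L)) => //.
- by apply: itv_in_0L; rewrite bnd_simp.
- by apply: kern_integrable_itv; rewrite bnd_simp.
- by case: hV.
Qed.

Lemma nonlocal_linear c V W : C1per L V -> C1per L W -> 
  nonlocal L (fun x => c * V x + W x) = fun x => c * nonlocal L V x + nonlocal L W x.
Proof.
move=> hV hW; have dE : derive1 (fun x => c * V x + W x) = fun x => c * derive1 V x + derive1 W x.
  apply/funext => x; rewrite derive1E.
  have := is_deriveD (is_deriveZ c (C1per_is_derive x hV)) (C1per_is_derive x hW).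
  by move=> /@derive_val <-.
have [_ _ cV] := hV; have [_ _ cW] := hW.
have int U x : C1per L U ->
   mu.-integrable `]0, L[ (EFin \o (fun y => `|y| `^ (- (1 / 3)) * derive1 U (x - y))).
  move=> [_ _ cU].
  have := @conv_integrable R L `]0, L[%classic (@kern R) _ _ _ _ x cU.
  move=> h; apply: eq_integrable (h _ _ _) => //.
  - by move=> y; rewrite inE /= in_itv /= => /andP[y0 _]; rewrite /kern ger0_norm // ltW.
  - by apply: itv_in_0L; rewrite bnd_simp.
  - by apply: kern_integrable_itv; rewrite bnd_simp.
apply/funext => x; rewrite /nonlocal dE -RintegralZl //; last exact: int.
rewrite -RintegralD //; last exact: int.
  by apply: eq_Rintegral => y _; ring.
by apply: integrable_scale => //; exact: int.
Qed.

(* Garding inequality: near the singularity the kernel has mass at most [1 / 2];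
   away from it, an integration by parts moves the derivative to the kernel. *)
Lemma nonlocal_garding : exists2 C, 0 <= C & forall V, C1per L V ->
  ip L (nonlocal L V) (derive1 V) <= ip L (derive1 V) (derive1 V) + C * ip L V V.
Proof.
have [e /andP[e0 eL] he] := kern_small L_gt0.
pose m1 := \int[mu]_(y in `[e, L]) dkern y.
pose m := @kern R e + kern L + m1.
have m1_ge0 : 0 <= m1 by apply: Rintegral_ge0 => y _; exact: dkern_ge0.
have ke0 := kern_ge0 e; have kL0 := kern_ge0 L.
have m0 : 0 <= m by rewrite !addr_ge0.
(* [m] is the total weight of the terms in [V]: two boundary terms and the mass of [dkern]. Young's
   inequality with parameter [m + 1] bounds them by [m * b], where [|V'|^2] has coefficient
   [m / (m + 1) / 2 <= 1 / 2]; the other half goes to the singular piece. Using [m + 1] makes the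
   parameter positive. *)
exists (m * (m + 1) / 2); first by rewrite divr_ge0 // mulr_ge0 // addr_ge0.
move=> V hV; have [pV _ cV'] := hV; have cV := C1per_continuous hV.
pose N := conv `]0, e] (@kern R) (derive1 V); pose P := conv `[e, L] (@dkern R) V.
have sN : forall y : R, `]0, e]%classic y -> 0 <= y <= L.
  by apply: itv_in_0L; rewrite bnd_simp // ltW.
have sP : forall y : R, `[e, L]%classic y -> 0 <= y <= L.
  by apply: itv_in_0L; rewrite bnd_simp // ltW.
have iN : mu.-integrable `]0, e] (EFin \o (@kern R)).
  by apply: kern_integrable_itv; rewrite bnd_simp // ltW.
have iP := dkern_integrable e0.
have cN : continuous N by exact: (continuous_conv (L := L)).
have cP : continuous P by exact: (continuous_conv (L := L)).
have cS c : continuous (fun x => V (x - c)) by exact: continuous_shift.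
have pV' := C1per_derive1_periodic hV.
pose X := ip L V V; pose Y := ip L (derive1 V) (derive1 V).
have X0 : 0 <= X by exact: ip_ge0.
have Y0 : 0 <= Y by exact: ip_ge0.
have a0 : 0 < m + 1 by rewrite ltr_wpDl.
pose b := ((m + 1) * X + (m + 1)^-1 * Y) / 2.
have hN : `|ip L N (derive1 V)| <= 1 / 2 * Y.
  have := ip_conv_young L_gt0 (measurable_itv _) sN iN (fun y _ => kern_ge0 y) ltr01 cV' cV' pV'.
  rewrite -/N -/Y invr1 (mul1r Y) => /le_trans; apply.
  have -> : (Y + Y) / 2 = Y by field.
  exact: ler_wpM2r.
have hP : `|ip L P (derive1 V)| <= m1 * b.
  exact: (ip_conv_young L_gt0 (measurable_itv _) sP iP (fun y _ => dkern_ge0 y) a0 cV cV' pV).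
have hS c : `|ip L (fun x => V (x - c)) (derive1 V)| <= b.
  have := ip_young L a0 (cS c) cV'.
  by rewrite (ip_shift L_gt0 (- c) cV pV).
have -> : ip L (nonlocal L V) (derive1 V) = ip L N (derive1 V) +
    kern e * ip L (fun x => V (x - e)) (derive1 V)
    - kern L * ip L (fun x => V (x - L)) (derive1 V) - ip L P (derive1 V).
  have -> : nonlocal L V = fun x => kern e * V (x - e) + (- kern L * V (x - L) + (-1 * P x + N x)).
    apply/funext => x; rewrite (@conv_kern_split V x e _ hV) ?e0 // -/(N x) -/(P x).
    by ring.
  have c1 := continuous_lincomb (a := -1) cP cN.
  have c2 := continuous_lincomb (a := - kern L) (cS L) c1.
  by rewrite !ip_linear //; ring.
move: hN hP (hS e) (hS L); rewrite !ler_norml => /andP[_ hN] /andP[hP _] /andP[_ hSe] /andP[hSL _].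
have h1 := ler_wpM2l ke0 hSe; have h2 := ler_wpM2l kL0 hSL.
have h3 : m * b <= m * (m + 1) / 2 * X + 1 / 2 * Y.
  have -> : m * b = m * (m + 1) / 2 * X + m / (m + 1) / 2 * Y by rewrite /b; field; rewrite gt_eqF.
  rewrite lerD2l ler_wpM2r // ler_pM2r ?invr_gt0 //.
  by rewrite ler_pdivrMr // mul1r lerDl.
have mE : m * b = kern e * b + kern L * b + m1 * b by rewrite /m; ring.
rewrite -/X -/Y; move: h3; rewrite mE; move: h1 h2 hN hP; rewrite mulrN; lra.
Qed.

End Nonlocal.

(** * The Crank-Nicolson step *)

Section CrankNicolson.
Variables (R : realType) (L : R).
Hypothesis L_gt0 : 0 < L.
Local Notation mu := (@lebesgue_measure R).
Implicit Types (u v w V W chi : R -> R) (c : R).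

Lemma derive1_lincomb c v w : C1per L v -> C1per L w ->
  derive1 (fun x => c * v x + w x) = fun x => c * derive1 v x + derive1 w x.
Proof.
move=> hv hw; apply/funext => x; rewrite derive1E.
have h := is_deriveD (is_deriveZ c (C1per_is_derive x hv)) (C1per_is_derive x hw).
exact: (@derive_val _ _ _ _ _ _ _ h).
Qed.

(** [V^2 V'] is the derivative of [V^3 / 3], which takes equal values at the two ends of the
    period. *)
Lemma ip_burgers_energy V : C1per L V -> ip L (fun x => V x * derive1 V x) V = 0.
Proof.
move=> hV; have [pV _ cV'] := hV; have cV := C1per_continuous hV.
have LL : - L < L by move: L_gt0; lra.
have dF x : - L <= x <= L -> is_derive x 1 (fun x => 1 / 3 * (V x * (V x * V x)))
    (V x * derive1 V x * V x).
  move=> _; have d := C1per_is_derive x hV.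
  have := is_deriveZ (1 / 3) (is_deriveM d (is_deriveM d d)).
  move=> h; apply: is_derive_eq h _; rewrite /GRing.scale /=.
  have E (s t : R) : 1 / 3 * (s * (s * t + s * t) + s * s * t) = s * t * s by field.
  exact: E.
rewrite /ip (Rintegral_is_derive LL _ dF); last first.
  exact: continuous_mul (continuous_mul cV cV') cV.
have -> : V L = V (- L) by rewrite -[RHS]pV /period; congr V; ring.
by rewrite subrr.
Qed.

(** The left side of the scheme for [u = U^n], [W = U^(n+1/2)] and [beta = 2 / dt], since
    [(U^(n+1) - U^n) / dt = beta * (W - u)]. *)
Definition cn_form (beta : R) u W chi : R :=
  beta * (ip L W chi - ip L u chi) + ip L (fun x => W x * derive1 W x) chi
  + ip L (derive1 W) (derive1 chi) - ip L (nonlocal L W) (derive1 chi).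

Lemma cn_form_linear beta u W c v w : continuous u -> C1per L W ->
  C1per L v -> C1per L w ->
  cn_form beta u W (fun x => c * v x + w x) = c * cn_form beta u W v + cn_form beta u W w.
Proof.
move=> cu hW hv hw; have [_ _ cv'] := hv; have [_ _ cw'] := hw; have [_ _ cW'] := hW.
have cv := C1per_continuous hv; have cw := C1per_continuous hw; have cW := C1per_continuous hW.
have cN := continuous_nonlocal L_gt0 hW.
have lin z y y' : continuous z -> continuous y -> continuous y' ->
    ip L z (fun x => c * y x + y' x) = c * ip L z y + ip L z y'.
  by move=> *; rewrite ip_sym ip_linear // !(ip_sym _ z).
have cWW := continuous_mul cW cW'.
rewrite /cn_form derive1_lincomb // (lin W) // (lin u) // (lin _ _ _ cWW) //.
rewrite (lin (derive1 W)) // (lin (nonlocal L W)) //.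
have E (a1 a2 a3 a4 a5 b1 b2 b3 b4 b5 : R) :
  beta * (c * a1 + b1 - (c * a2 + b2)) + (c * a3 + b3) + (c * a4 + b4) - (c * a5 + b5) =
  c * (beta * (a1 - a2) + a3 + a4 - a5) + (beta * (b1 - b2) + b3 + b4 - b5) by ring.
exact: E.
Qed.

(** The term [|V'|^2] of the form is used up exactly by the hypothesis on [nonlocal]; Young's
    inequality with a free parameter [a] handles [(u, V)]. *)
Lemma cn_form_ge (C beta a : R) u V :
  (forall W, C1per L W ->
    ip L (nonlocal L W) (derive1 W) <= ip L (derive1 W) (derive1 W) + C * ip L W W) ->
  0 < beta -> 0 < a -> continuous u -> C1per L V ->
  beta * (ip L V V - (a * ip L u u + a^-1 * ip L V V) / 2) - C * ip L V V <= cn_form beta u V V.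
Proof.
move=> hC b0 a0 cu hV; rewrite /cn_form ip_burgers_energy // addr0.
have := ip_young L a0 cu (C1per_continuous hV); rewrite ler_norml => /andP[_ h1].
move: h1 (hC V hV).
move: (ip L V V) (ip L u u) (ip L u V) (ip L (derive1 V) _) (ip L (nonlocal L V) _).
move=> x y z s t h1 h2; have := ler_wpM2l (ltW b0) h1; rewrite !mulrBr; lra.
Qed.

Section Space.
Variable S : set (R -> R).
Hypothesis linS : linear_subspace S.
Hypothesis S_C1 : forall v, S v -> C1per L v.

Let S_cont v : S v -> continuous v.
Proof. by move=> /S_C1 /C1per_continuous. Qed.

(** In coordinates the form is a polynomial of degree at most two: [l] collects the terms linear in
    [W], [q] is the bilinear convective term. *)
Lemma continuous_cn_form n (e : 'I_n -> R -> R) beta u chi :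
  (forall k, S (e k)) -> continuous u -> C1per L chi ->
  continuous (fun c : 'rV[R]_n => cn_form beta u (fun x => \sum_k c 0 k * e k x) chi).
Proof.
move=> Se cu hchi; have [_ _ cchi'] := hchi; have cchi := C1per_continuous hchi.
pose l W := beta * ip L W chi + ip L (derive1 W) (derive1 chi) - ip L (nonlocal L W) (derive1 chi).
pose q V W := ip L (fun x => V x * derive1 W x) chi.
have c' v : S v -> continuous (derive1 v) by move=> /S_C1[].
have cN v : S v -> continuous (nonlocal L v) by move=> /S_C1; exact: continuous_nonlocal.
have l_lin a v w : S v -> S w -> l (fun x => a * v x + w x) = a * l v + l w.
  move=> Sv Sw; have hv := S_C1 Sv; have hw := S_C1 Sw.
  rewrite /l (derive1_lincomb a hv hw) (nonlocal_linear L_gt0 a hv hw).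
  rewrite (ip_linear L a cchi (S_cont Sv) (S_cont Sw)).
  rewrite (ip_linear L a cchi' (c' _ Sv) (c' _ Sw)) (ip_linear L a cchi' (cN _ Sv) (cN _ Sw)).
  have E (a1 a2 a3 b1 b2 b3 : R) : beta * (a * a1 + b1) + (a * a2 + b2) - (a * a3 + b3) =
    a * (beta * a1 + a2 - a3) + (beta * b1 + b2 - b3) by ring.
  exact: E.
have cq v w : S v -> S w -> continuous (fun x => v x * derive1 w x).
  by move=> Sv Sw; apply: continuous_mul; [exact: S_cont | exact: c'].
have q_linl W a v w : S W -> S v -> S w -> q (fun x => a * v x + w x) W = a * q v W + q w W.
  move=> SW Sv Sw; rewrite /q -(ip_linear L a cchi (cq _ _ Sv SW) (cq _ _ Sw SW)).
  by congr ip; apply/funext => x; rewrite mulrDl mulrA.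
have q_linr V a v w : S V -> S v -> S w -> q V (fun x => a * v x + w x) = a * q V v + q V w.
  move=> SV Sv Sw; rewrite /q (derive1_lincomb a (S_C1 Sv) (S_C1 Sw)).
  rewrite -(ip_linear L a cchi (cq _ _ SV Sv) (cq _ _ SV Sw)).
  by congr ip; apply/funext => x; rewrite mulrDr mulrCA.
have -> : (fun c : 'rV[R]_n => cn_form beta u (fun x => \sum_k c 0 k * e k x) chi) =
    fun c : 'rV[R]_n => \sum_k c 0 k * l (e k) + \sum_k c 0 k * (\sum_j c 0 j * q (e j) (e k)) +
             - (beta * ip L u chi).
  apply/funext => c; set V := fun x => \sum_k c 0 k * e k x.
  have SV : S V by exact: subspace_sum.
  transitivity (l V + q V V - beta * ip L u chi).
    have E (a1 a2 a3 a4 a5 : R) : beta * (a1 - a2) + a3 + a4 - a5 = beta * a1 + a4 - a5 + a3 - beta * a2.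
      by ring.
    exact: E.
  rewrite {1}/V (linear_form_sum linS) //; congr (_ + _ - _).
  rewrite [in X in q V X]/V (linear_form_sum linS (l := q V)) //; last by move=> *; exact: q_linr.
  apply: eq_bigr => k _; rewrite {1}/V (linear_form_sum linS (l := q ^~ (e k))) //.
  by move=> *; exact: q_linl.
have cs (g : 'I_n -> 'rV[R]_n -> R) : (forall k, continuous (g k)) ->
    continuous (fun c : 'rV[R]_n => \sum_k c 0 k * g k c).
  move=> cg; apply: continuous_sum => k c.
  exact: cvgM (@coord_continuous _ _ _ 0 k c) (cg k c).
have cc (a : R) : continuous (fun _ : 'rV[R]_n => a) by exact: cst_continuous.
have c1 := cs (fun k _ => l (e k)) (fun k => cc _).
have c2 := cs _ (fun k => cs (fun j _ => q (e j) (e k)) (fun j => cc _)).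
by move=> c; exact: cvgD (cvgD (c1 c) (c2 c)) (cvg_cst _).
Qed.

Lemma cn_step (C beta : R) u :
  (forall W, C1per L W ->
    ip L (nonlocal L W) (derive1 W) <= ip L (derive1 W) (derive1 W) + C * ip L W W) ->
  0 <= C -> C < beta -> finite_dimensional S -> S u ->
  exists2 W, S W & forall chi, S chi -> cn_form beta u W chi = 0.
Proof.
move=> hC C0 Cb fdS Su; have b0 : 0 < beta by exact: le_lt_trans Cb.
have cu := S_cont Su.
have [||m [e [Se ortho espan]]] := @orthonormal_basis R S linS (ip L) (@ip_sym R L) _ _ fdS.
- by move=> w a v v' Sw Sv Sv'; apply: ip_linear; exact: S_cont.
- by move=> v Sv; apply: ip_gt0 => //; [exact: S_cont | case: (S_C1 Sv)].
pose V (c : 'rV[R]_m) (x : R) := \sum_k c 0 k * e k x.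
have SV (c : 'rV[R]_m) : S (V c) by exact: subspace_sum.
have form_sum (c d : 'rV[R]_m) : cn_form beta u (V c) (V d) = \sum_k d 0 k * cn_form beta u (V c) (e k).
  apply: (linear_form_sum linS (l := cn_form beta u (V c))) => // a v w Sv Sw.
  exact: cn_form_linear (S_C1 (SV c)) (S_C1 Sv) (S_C1 Sw).
have ipV (c : 'rV[R]_m) : ip L (V c) (V c) = enorm c ^+ 2.
  rewrite sqr_enorm; have lin1 w : S w -> ip L (V c) w = \sum_k c 0 k * ip L (e k) w.
    move=> Sw; apply: (linear_form_sum linS (l := (ip L) ^~ w)) => // a v v' Sv Sv'.
    by apply: ip_linear; exact: S_cont.
  rewrite lin1 //; apply: eq_bigr => k _; rewrite ip_sym lin1 // (bigD1 k) //=.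
  rewrite ortho eqxx mulr1 big1 ?addr0 // => j jk.
  by rewrite ortho (negbTE jk) mulr0.
pose g := beta - C; have g0 : 0 < g by rewrite subr_gt0.
(* With this choice [beta / (2 a) = g / 2], so half of the gap [g] remains in front of [|V|^2]. *)
pose a := beta / g; have a0 : 0 < a by rewrite divr_gt0.
(* The form is then at least [g / 2 * (|V|^2 - K)]; the radius [1 + K] is enough, as
   [(1 + K)^2 > K]. *)
pose K := beta * a * ip L u u / g.
have K0 : 0 <= K := divr_ge0 (mulr_ge0 (ltW (mulr_gt0 b0 a0)) (ip_ge0 L u)) (ltW g0).
have rho0 : 0 < 1 + K by exact: ltr_pwDl.
have [||c hc] := @coercive_zero R m (1 + K) (fun i (c : 'rV[R]_m) => cn_form beta u (V c) (e i)) rho0.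
- by move=> i; apply: continuous_cn_form => //; exact: S_C1.
- move=> c hc; rewrite -form_sum.
  apply: lt_le_trans (cn_form_ge hC b0 a0 cu (S_C1 (SV c))).
  rewrite ipV hc; set r := (1 + K) ^+ 2.
  have -> : beta * (r - (a * ip L u u + a^-1 * r) / 2) - C * r = g / 2 * (r - K).
    by rewrite /K /a /g; field; rewrite !gt_eqF // subr_gt0.
  rewrite mulr_gt0 ?divr_gt0 // /r; move: (sqr_ge0 K); rewrite sqrrD; lra.
exists (V c) => // chi /espan[d ->].
have -> : (fun x => \sum_(j < m) d j * e j x) = V (\row_j d j).
  by apply/funext => x; apply: eq_bigr => j _; rewrite mxE.
by rewrite form_sum big1 // => k _; rewrite hc mulr0.
Qed.

End Space.
End CrankNicolson.

(** * Choice of the threshold and iteration of the step *)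

Theorem proposition4p2 (R : realType) (L T : R) (r : nat)
    (I : Type) (p : I -> seq R) (S : I -> set (R -> R))
    (hL : 0 < L) (hT : 0 < T) (hr : (2 <= r)%N)
    (hS : forall i : I, fe_space L r (p i) (S i))
    (happrox : approximation_property L r p S) :
  exists2 delta : R, 0 < delta &
  forall (N : nat) (i : I), (0 < N)%N -> T / N%:R < delta ->
  forall u0 : R -> R, S i u0 ->
  exists U : nat -> R -> R,
    [/\ forall n : nat, (n <= N)%N -> S i (U n),
        U 0%N = u0 &
        forall (n : nat) (chi : R -> R), (n < N)%N -> S i chi ->
          ip L (diffquot (T / N%:R) U n) chi
          + ip L (fun x => midpoint U n x * derive1 (midpoint U n) x) chi
          + ip L (derive1 (midpoint U n)) (derive1 chi)
          - ip L (nonlocal L (midpoint U n)) (derive1 chi) = 0].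
Proof.
have [C C0 hC] := nonlocal_garding hL.
have C1 : 0 < C + 1 by rewrite ltr_wpDl.
(* [C] is fixed before [N], [i] and [u0]. The denominator [C + 1] is positive even if [C = 0], and
   [dt < delta] gives [C < C + 1 < 2 / dt]. *)
exists (2 / (C + 1)) => [|N i N0 hN u0 Su0]; first by rewrite divr_gt0.
pose dt := T / N%:R; have dt0 : 0 < dt by rewrite divr_gt0 ?ltr0n.
have Cb : C < 2 / dt.
  rewrite ltr_pdivlMr // mulrC (@le_lt_trans _ _ (dt * (C + 1))) //.
    by rewrite ler_pM2l // lerDl.
  by rewrite -ltr_pdivlMr.
have [_ linS fdS _ S_C1 _] := hS i.
(* [choice] needs a witness for every function [u]; outside [S i] the value [u] is a dummy. *)
have /choice[f hf] : forall u, exists W, S i u ->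
    S i W /\ forall chi, S i chi -> cn_form L (2 / dt) u W chi = 0.
  move=> u; have [Su|nSu] := pselect (S i u); last by exists u => /nSu.
  by have [W SW hW] := cn_step hL linS S_C1 hC C0 Cb fdS Su; exists W.
(* This is [2 W - u], written in the shape that [linear_subspace] accepts. *)
pose next u (x : R) := -1 * u x + (2 * f u x + 0).
pose U n := iter n next u0.
have SU n : S i (U n).
  elim: n => // n IH; apply: (linS.2 (-1) _ _ IH).
  by apply: (linS.2 2 (f (U n)) (fun=> 0)); [case: (hf _ IH) | exact: linS.1].
exists U; split => // n chi _ Schi; have [SW hW] := hf _ (SU n).
have midE : midpoint U n = f (U n).
  by apply/funext => x; rewrite /midpoint /= /next; field.
have diffE : diffquot dt U n = fun x => 2 / dt * (-1 * U n x + f (U n) x).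
  by apply/funext => x; rewrite /diffquot /= /next; field; rewrite gt_eqF.
have cU := C1per_continuous (S_C1 _ (SU n)).
have cW := C1per_continuous (S_C1 _ SW).
have cchi := C1per_continuous (S_C1 _ Schi).
rewrite midE -/dt diffE ipZl //; last exact: continuous_lincomb.
rewrite ip_linear // -[RHS](hW _ Schi) /cn_form; congr (_ + _ + _ - _).
by rewrite mulN1r [in RHS]addrC.
Qed.
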